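(* Suppose that $\mathfrak p=(p_d)_{d\ge1}$ and $\mathfrak q=(q_d)_{d\ge1}$, with $p_d,q_d\in\mathcal P_d(\mathbb R)$, are two sequences of polynomials with infinitesimal distributions $(\mu,\mu')$ and $(\nu,\nu')$, respectively. Let $(\gamma,\gamma')$ denote the infinitesimal free additive convolution $(\mu,\mu')\boxplus_B(\nu,\nu')$. If $\nu=\delta_0$, then the finite-free additive convolution $\mathfrak p\boxplus\mathfrak q=(p_d\boxplus_d q_d)_{d\ge1}$ has infinitesimal distribution $(\gamma,\gamma')$.
   Context: $\delta_0$ is the Dirac mass at $0$. $\mathcal P_d(\mathbb R)$ is the set of monic real polynomials of degree $d$ with only real roots. For $p_d\in\mathcal P_d(\mathbb R)$ with roots $\lambda_1,\dots,\lambda_d$ (with multiplicity), $m_n(p_d)=\frac1d\sum_k\lambda_k^n$. Write $p_d(x)=\sum_{k=0}^d x^{d-k}(-1)^k\binom dk\mathsf e_k(p_d)$. The finite-free additive convolution is $[p_d\boxplus_d q_d](x)=\sum_{k=0}^d x^{d-k}(-1)^k\binom dk\bigl[\sum_{i=0}^k\binom ki\mathsf e_i(p_d)\mathsf e_{k-i}(q_d)\bigr]$ (again in $\mathcal P_d(\mathbb R)$). A sequence $\mathfrak p$ has infinitesimal distribution $(\mu,\mu')$ if $\mu$ is a probability distribution on $\mathbb R$ with finite moments $m_n(\mu)$ of all orders, $m_n(p_d)\to m_n(\mu)$ for all $n\ge0$, the limits $m_n'(\mathfrak p)=\lim_{d\to\infty}d\,(m_n(p_d)-m_n(\mu))$ exist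 for all $n\ge1$, and $\mu':\mathbb R[x]\to\mathbb R$ is the linear functional with $\mu'(1)=0$, $\mu'(x^n)=m_n'(\mathfrak p)$. Write $m_n(\mu')=\mu'(x^n)$. $NC(n)$ is the set of non-crossing partitions of $\{1,\dots,n\}$; for a sequence $(u_n)$, $u_\pi=\prod_{V\in\pi}u_{|V|}$ and $u_{\pi\setminus V}=\prod_{W\in\pi,W\ne V}u_{|W|}$. Free cumulants $r_n(\mu)$ are defined recursively by $m_n(\mu)=\sum_{\pi\in NC(n)}r_\pi(\mu)$. Throughout, only distributions determined by their moments are considered; $\mu\boxplus\nu$ is the probability measure with $r_n(\mu\boxplus\nu)=r_n(\mu)+r_n(\nu)$ for all $n\ge1$. Infinitesimal free cumulants $r_n'(\mu,\mu')$ are defined recursively by $m_n(\mu')=\sum_{\pi\in NC(n)}\sum_{V\in\pi}r'_{|V|}(\mu,\mu')\,r_{\pi\setminus V}(\mu)$. The infinitesimal free additive convolution $(\mu,\mu')\boxplus_B(\nu,\nu')=(\gamma,\gamma')$ is given by $\gamma=\mu\boxplus\nu$ and $\gamma'$ the linear functional on $\mathbb R[x]$ with $\gamma'(1)=0$ and $r_n'(\gamma,\gamma')=r_n'(\mu,\mu')+r_n'(\nu,\nu')$ for all $n\ge1$. *)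

(* Defs.v *)
From HB Require Import structures.
From mathcomp Require Import all_boot all_order all_algebra.
From mathcomp Require Import all_classical all_reals all_analysis.

Set Implicit Arguments.
Unset Strict Implicit.
Unset Printing Implicit Defensive.

Import Order.TTheory GRing.Theory Num.Theory.
Import numFieldNormedType.Exports.

Local Open Scope ring_scope.

(** * Real-rooted polynomials and the finite-free additive convolution *)

Section Polynomials.
Local Open Scope classical_set_scope.
Context {R : realType}.
Implicit Types (p q : {poly R}) (d k n : nat).

Definition real_rooted d : set {poly R} :=
  [set p | [/\ p \is monic, size p = d.+1 &
    exists s : seq R, p = \prod_(a <- s) ('X - a%:P)]].

(* The roots of a real-rooted monic polynomial, listed with multiplicity in an
   unspecified order; the junk value [::] is taken for other polynomials. *)
Definition real_roots p : seq R :=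
  xget [::] [set s : seq R | p = \prod_(a <- s) ('X - a%:P)].

Definition poly_moment d p n : R :=
  d%:R^-1 * \sum_(a <- real_roots p) a ^+ n.

(* e_k(p), where p(x) = \sum_(k <= d) x^(d-k) (-1)^k binom(d,k) e_k(p). *)
Definition ffcoef d p k : R := (-1) ^+ k * p`_(d - k) / 'C(d, k)%:R.

Definition ffconv d p q : {poly R} :=
  \sum_(k < d.+1)
    ((-1) ^+ k * 'C(d, k)%:R *
      \sum_(i < k.+1) 'C(k, i)%:R * ffcoef d p i * ffcoef d q (k - i))
    *: 'X^(d - k).

Lemma ffcoefE d p : size p = d.+1 ->
  p = \sum_(k < d.+1) ((-1) ^+ k * 'C(d, k)%:R * ffcoef d p k) *: 'X^(d - k).
Proof.
move=> sp; rewrite -[LHS]coefK poly_def sp (reindex_inj rev_ord_inj) /=.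
apply: eq_bigr => -[k /= kd] _; rewrite subSS /ffcoef.
have C0 : 'C(d, k)%:R != 0 :> R by rewrite pnatr_eq0 -lt0n bin_gt0.
congr (_ *: _); rewrite -mulrA (mulrC 'C(d, k)%:R) divfK //.
by rewrite mulrA -expr2 sqrr_sign mul1r.
Qed.

End Polynomials.

(** * Non-crossing partitions and (infinitesimal) free cumulants *)

Definition noncrossing n (P : {set {set 'I_n}}) : bool :=
  [forall V in P, forall W in P, (V != W) ==>
    ~~ [exists i in V, exists j in W, exists k in V, exists l in W,
         [&& i < j, j < k & k < l]%N]].

Definition NC n : {set {set {set 'I_n}}} :=
  [set P | finset.partition P [set: 'I_n] & noncrossing P].

Section Cumulants.
Context {R : realType}.
Implicit Types (m r u v : nat -> R) (n : nat).

Definition prod_blocks u n (P : {set {set 'I_n}}) : R :=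
  \prod_(V in P) u #|V|.

Definition prod_blocks_except u n (P : {set {set 'I_n}}) (V : {set 'I_n}) : R :=
  \prod_(W in P | W != V) u #|W|.

(* strong_rec F is the sequence u with u 0 = 0 and u n = F n u for n > 0,
   provided that F n u depends only on the u j with j < n. *)
Fixpoint strong_rec_upto (F : nat -> (nat -> R) -> R) n : nat -> R :=
  if n is k.+1 then
    let u := strong_rec_upto F k in
    fun j => if j == k.+1 then F k.+1 u else u j
  else fun=> 0.

Definition strong_rec (F : nat -> (nat -> R) -> R) n : R :=
  strong_rec_upto F n n.

(* Here [set [set: 'I_n]] is the one-block partition, whose term in the
   moment-cumulant formula is r n; see moment_free_cumulant and
   free_cumulant_unique below. *)
Definition free_cumulant m : nat -> R :=
  strong_rec (fun n r =>
    m n - \sum_(P in NC n | P != [set [set: 'I_n]]) prod_blocks r P).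

Definition inf_free_cumulant m (m' : nat -> R) : nat -> R :=
  let r := free_cumulant m in
  strong_rec (fun n r' =>
    m' n - \sum_(P in NC n | P != [set [set: 'I_n]])
             \sum_(V in P) r' #|V| * prod_blocks_except r P V).

Lemma strong_rec_uptoE F n j : (j <= n)%N -> strong_rec_upto F n j = strong_rec F j.
Proof.
elim: n => [|n IH]; first by rewrite leqn0 => /eqP ->.
rewrite leq_eqVlt => /orP[/eqP -> //|jn] /=.
by rewrite (ltn_eqF jn) IH.
Qed.

Lemma strong_recE F n :
  (forall k u v, (forall j, (j < k)%N -> u j = v j) -> F k u = F k v) ->
  (0 < n)%N -> strong_rec F n = F n (strong_rec F).
Proof.
case: n => // n Fext _; rewrite /strong_rec /= eqxx; apply: Fext => j jn.
exact: strong_rec_uptoE.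
Qed.

Lemma card_block_lt n (P : {set {set 'I_n}}) (V : {set 'I_n}) :
  P \in NC n -> P != [set [set: 'I_n]] -> V \in P -> (#|V| < n)%N.
Proof.
rewrite inE => /andP[partP _] neP VP; rewrite ltnNge; apply: contra neP => leV.
have VT : V = [set: 'I_n].
  by apply/eqP; rewrite eqEcard finset.subsetT cardsT card_ord.
have /and3P[_ triv P0] := partP.
apply/eqP/setP => W; rewrite inE; apply/idP/eqP => [WP|->]; last by rewrite -VT.
apply/eqP; apply: contraT => neW.
have /finset.trivIsetP/(_ W V WP VP) := triv; rewrite VT => /(_ neW).
rewrite -finset.setI_eq0 finset.setIT => /eqP W0; by rewrite -W0 WP in P0.
Qed.

Lemma NC_one n : (0 < n)%N -> [set [set: 'I_n]] \in NC n.
Proof.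
move=> n0; rewrite inE; apply/andP; split.
  rewrite /finset.partition /finset.cover big_set1 eqxx /=; apply/andP; split.
    by apply/finset.trivIsetP => A B /set1P -> /set1P ->; rewrite eqxx.
  by rewrite inE eq_sym -card_gt0 cardsT card_ord.
by apply/forall_inP => V /set1P ->; apply/forall_inP => W /set1P ->; rewrite eqxx.
Qed.

Let one_block n (F : {set 'I_n} -> R) :
  \sum_(V in [set [set: 'I_n]]) F V = F [set: 'I_n].
Proof. by rewrite big_set1. Qed.

Lemma moment_free_cumulant m n : (0 < n)%N ->
  m n = \sum_(P in NC n) prod_blocks (free_cumulant m) P.
Proof.
move=> n0; rewrite (bigD1 _ (NC_one n0)) /= {1}/prod_blocks big_set1.
rewrite cardsT card_ord {1}/free_cumulant strong_recE ?subrK // => k u v uv.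
congr (_ - _); apply: eq_bigr => P /andP[PN P1]; apply: eq_bigr => V VP.
exact/uv/(card_block_lt PN).
Qed.

Lemma free_cumulant_unique m r :
  (forall n, (0 < n)%N -> m n = \sum_(P in NC n) prod_blocks r P) ->
  forall n, (0 < n)%N -> r n = free_cumulant m n.
Proof.
move=> mr; elim/ltn_ind => n IH n0.
have := mr n n0; rewrite (moment_free_cumulant m n0).
rewrite !(bigD1 _ (NC_one n0)) /= {1 3}/prod_blocks !big_set1 cardsT card_ord.
have -> : \sum_(P in NC n | P != [set [set: 'I_n]]) prod_blocks r P =
  \sum_(P in NC n | P != [set [set: 'I_n]]) prod_blocks (free_cumulant m) P.
  apply: eq_bigr => P /andP[PN P1]; apply: eq_bigr => V VP.
  apply: IH; first exact: (card_block_lt PN).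
  rewrite card_gt0; apply: contraTneq PN => V0.
  by rewrite inE /finset.partition -V0 VP /= !andbF.
by move/addIr.
Qed.

Lemma moment_inf_free_cumulant m (m' : nat -> R) n : (0 < n)%N ->
  m' n = \sum_(P in NC n) \sum_(V in P)
           inf_free_cumulant m m' #|V| * prod_blocks_except (free_cumulant m) P V.
Proof.
move=> n0; rewrite (bigD1 _ (NC_one n0)) /= one_block.
rewrite {1}/prod_blocks_except big1 => [|W /andP[/set1P ->]]; last by rewrite eqxx.
rewrite mulr1 cardsT card_ord {1}/inf_free_cumulant strong_recE ?subrK // => k u v uv.
congr (_ - _); apply: eq_bigr => P /andP[PN P1]; apply: eq_bigr => V VP.
by congr (_ * _); exact/uv/(card_block_lt PN).
Qed.

End Cumulants.

(** * Distributions, infinitesimal distributions and convolutions *)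

Section Distributions.
Local Open Scope classical_set_scope.
Context {R : realType}.
Implicit Types mu nu gamma : probability (measurableTypeR R) R.

Definition finite_moments mu :=
  forall n, mu.-integrable setT (fun x : measurableTypeR R => ((x : R) ^+ n)%:E).

Definition moment mu n : R := \int[mu]_x ((x : R) ^+ n).

(* Measures are compared on Borel sets only, since a MathComp-Analysis measure
   is unconstrained on non-measurable sets. *)
Definition moment_determinate mu :=
  forall nu, finite_moments nu -> (forall n, moment nu n = moment mu n) ->
    forall A, measurable A -> nu A = mu A.

Definition inf_moment (mu' : {scalar {poly R}}) n : R := mu' 'X^n.

(* The value p 0 is irrelevant. *)
Definition has_inf_distribution (p : nat -> {poly R}) mu
    (mu' : {scalar {poly R}}) :=
  [/\ forall d, (0 < d)%N -> real_rooted d (p d),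
      finite_moments mu,
      forall n, (fun d => poly_moment d (p d) n) @ \oo --> moment mu n,
      mu' 1 = 0 &
      forall n, (0 < n)%N ->
        (fun d => d%:R * (poly_moment d (p d) n - moment mu n)) @ \oo
          --> inf_moment mu' n].

Definition is_free_conv mu nu gamma :=
  [/\ finite_moments gamma, moment_determinate gamma &
      forall n, (0 < n)%N ->
        free_cumulant (moment gamma) n =
        free_cumulant (moment mu) n + free_cumulant (moment nu) n].

Definition is_inf_free_conv mu (mu' : {scalar {poly R}}) nu (nu' : {scalar {poly R}})
    gamma (gamma' : {scalar {poly R}}) :=
  [/\ is_free_conv mu nu gamma, gamma' 1 = 0 &
      forall n, (0 < n)%N ->
        inf_free_cumulant (moment gamma) (inf_moment gamma') n =
        inf_free_cumulant (moment mu) (inf_moment mu') n +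
        inf_free_cumulant (moment nu) (inf_moment nu') n].

End Distributions.

(* Main.v *)
Require Import Defs.
From HB Require Import structures.
From mathcomp Require Import all_boot all_order all_algebra.
From mathcomp Require Import all_classical all_reals all_analysis.
From mathcomp Require Import ring zify complex.

Set Implicit Arguments.
Unset Strict Implicit.
Unset Printing Implicit Defensive.

Import Order.TTheory GRing.Theory Num.Theory.
Import numFieldNormedType.Exports.

Local Open Scope ring_scope.

(** The power sums of the roots of q_d are d m_n(q_d) and converge to m_n(nu'),
    so each e_k(q_d) with k > 0 is O(1/d). Convolving with q_d therefore changes
    the moments of p_d by O(1/d) only, and the point is to compute the limit of
    d times this change.

    The convolution is a differential operator applied to p_d, namely
    sum_k (-1)^k E_k(q_d) p_d^(k) / (d)_k, where E_k is the elementary symmetric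
    function of the roots and (d)_k = d (d - 1) ... (d - k + 1). Write M for the
    moment series of mu, g = t M(t), and expand everything in t = 1/x. The
    quotient p_d' / (d p_d) tends to g, hence p_d^(k) / ((d)_k p_d) tends to g^k
    (deriv_quotient_cvg), and (-1)^k E_k(q_d) tends to the coefficient a_k of a
    series a determined by nu' through Newton's identities (rev_prod_cvg). The
    quotient of the convolution by p_d thus tends to a(g), and the logarithmic
    derivative of this quotient is the difference of the power sums of the roots
    (power_sums_ffconv), which consequently converge to a series x with
    D(a(g)) = - a(g) x, D being the Euler operator t d/dt.

    On the side of cumulants, nu = delta_0 gives gamma = mu, and nu' is its own
    sequence of infinitesimal free cumulants. Splitting a non-crossing partition
    along the block of its first element yields the recursion first_moment_rec,
    whose first-order variation is the identity M' g = u(g) D g between the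
    infinitesimal moments M' and the infinitesimal cumulants u
    (inf_moment_cumulant_fps). By linearity in u, the difference of the
    infinitesimal moments of gamma' and mu' is the solution of x g = nu'(g) D g,
    and the chain rule identifies it with the limit above.

    That the convolution has only real roots is Walsh's theorem. It follows from
    Grace's apolarity theorem for a half-plane (apolar_neq0), itself an iteration
    of Laguerre's theorem on polar derivatives (polar_deriv_lower). *)

(** * Formal power series *)

Definition fps (K : comNzRingType) : Type := nat -> K.

HB.instance Definition _ (K : comNzRingType) := gen_eqMixin (fps K).
HB.instance Definition _ (K : comNzRingType) := gen_choiceMixin (fps K).

Section FormalPowerSeries.
Variable K : comNzRingType.
Implicit Types (f g h : fps K) (c : K) (n k : nat).

Definition fpsC c : fps K := fun n => if n is 0 then c else 0.
Definition fps_add f g : fps K := fun n => f n + g n.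
Definition fps_opp f : fps K := fun n => - f n.
Definition fps_mul f g : fps K := fun n => \sum_(i < n.+1) f i * g (n - i)%N.

Lemma fpsP f g : (forall n, f n = g n) -> f = g.
Proof. exact: funext. Qed.

Fact fps_addA : associative fps_add.
Proof. by move=> f g h; apply: fpsP => n; rewrite /fps_add addrA. Qed.
Fact fps_addC : commutative fps_add.
Proof. by move=> f g; apply: fpsP => n; rewrite /fps_add addrC. Qed.
Fact fps_add0 : left_id (fpsC 0) fps_add.
Proof. by move=> f; apply: fpsP => -[|n]; rewrite /fps_add add0r. Qed.
Fact fps_addN : left_inverse (fpsC 0) fps_opp fps_add.
Proof. by move=> f; apply: fpsP => -[|n]; rewrite /fps_add addNr. Qed.

HB.instance Definition _ :=
  GRing.isZmodule.Build (fps K) fps_addA fps_addC fps_add0 fps_addN.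

(* The ring axioms are inherited from polynomials, because a coefficient of a
   product only depends on finitely many coefficients of the factors. *)
Let trunc N f : {poly K} := \poly_(i < N) f i.

Let fps_mul_trunc N f g n : (n < N)%N ->
  fps_mul f g n = (trunc N f * trunc N g)`_n.
Proof.
move=> nN; rewrite coefM; apply: eq_bigr => i _.
by rewrite !coef_poly !(leq_ltn_trans _ nN) ?leq_subr // -ltnS.
Qed.

Fact fps_mulA : associative fps_mul.
Proof.
move=> f g h; apply: fpsP => n.
transitivity ((trunc n.+1 f * (trunc n.+1 g * trunc n.+1 h))`_n).
  rewrite coefM; apply: eq_bigr => i _; rewrite (fps_mul_trunc (N := n.+1)).
    by rewrite coef_poly ltn_ord.
  by rewrite ltnS leq_subr.
rewrite mulrA coefM; apply: eq_bigr => i _; rewrite (fps_mul_trunc (N := n.+1)) //.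
by rewrite coef_poly ltnS leq_subr.
Qed.

Fact fps_mulC : commutative fps_mul.
Proof. by move=> f g; apply: fpsP => n; rewrite !(@fps_mul_trunc n.+1) // mulrC. Qed.

Fact fps_mul1 : left_id (fpsC 1) fps_mul.
Proof.
move=> f; apply: fpsP => n; rewrite /fps_mul big_ord_recl subn0 mul1r.
by rewrite big1 ?addr0 // => i _; rewrite mul0r.
Qed.

Fact fps_mulDl : left_distributive fps_mul fps_add.
Proof.
move=> f g h; apply: fpsP => n; rewrite /fps_add /fps_mul -big_split.
by apply: eq_bigr => i _; rewrite mulrDl.
Qed.

Fact fps_oner_neq0 : fpsC 1 != 0.
Proof. by apply/eqP => /(congr1 (fun f : fps K => f 0%N))/eqP; rewrite oner_eq0. Qed.

HB.instance Definition _ :=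
  GRing.Zmodule_isComNzRing.Build (fps K) fps_mulA fps_mulC fps_mul1 fps_mulDl
    fps_oner_neq0.

Lemma fpsE0 n : (0 : fps K) n = 0. Proof. by case: n. Qed.
Lemma fpsE1 n : (1 : fps K) n = (n == 0)%:R. Proof. by case: n. Qed.
Lemma fpsED f g n : (f + g) n = f n + g n. Proof. by []. Qed.
Lemma fpsEN f n : (- f) n = - f n. Proof. by []. Qed.
Lemma fpsEM f g n : (f * g) n = \sum_(i < n.+1) f i * g (n - i)%N. Proof. by []. Qed.

Lemma fpsEM0 f g : (f * g) 0%N = f 0%N * g 0%N.
Proof. by rewrite fpsEM big_ord1. Qed.

Lemma fpsECM c f n : (fpsC c * f) n = c * f n.
Proof.
by rewrite fpsEM big_ord_recl subn0 big1 ?addr0 // => i _; rewrite mul0r.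
Qed.

Definition fpsX : fps K := fun n => (n == 1)%:R.

Lemma fpsEXM f n : (fpsX * f) n = if n is k.+1 then f k else 0.
Proof.
case: n => [|n]; first by rewrite fpsEM0 mul0r.
rewrite fpsEM 2!big_ord_recl mul0r mul1r add0r subn1 big1 ?addr0 // => i _.
by rewrite mul0r.
Qed.

Lemma fpsC1 : fpsC 1 = 1. Proof. by []. Qed.
Lemma fpsC0 : fpsC 0 = 0. Proof. by []. Qed.

Lemma fpsCM c c' : fpsC (c * c') = fpsC c * fpsC c'.
Proof. by apply: fpsP => n; rewrite fpsECM; case: n => // n; rewrite mulr0. Qed.

Lemma fpsX_inj f g : fpsX * f = fpsX * g -> f = g.
Proof.
move=> fg; apply: fpsP => n.
by have := congr1 (fun h : fps K => h n.+1) fg; rewrite !fpsEXM.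
Qed.

Lemma fps_mulI f g h : f 0%N = 1 -> f * g = f * h -> g = h.
Proof.
move=> f0 fgh; apply: fpsP; elim/ltn_ind => n IH.
have := congr1 (fun h : fps K => h n) fgh.
rewrite /= !fpsEM !big_ord_recl f0 !mul1r subn0 => /eqP.
rewrite -subr_eq -addrA -sumrB big1 ?addr0 => [/eqP //|i _].
by rewrite IH ?subrr // ltn_subrL /= (leq_ltn_trans _ (ltn_ord i)).
Qed.

(** The Euler operator t d/dt: unlike the derivative, it keeps degrees, and it
    only changes sign under the substitution t = 1/x. *)
Definition fpsD f : fps K := fun n => n%:R * f n.

Lemma fpsDD f g : fpsD (f + g) = fpsD f + fpsD g.
Proof. by apply: fpsP => n; rewrite /fpsD !fpsED mulrDr. Qed.

Lemma fpsDM f g : fpsD (f * g) = fpsD f * g + f * fpsD g.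
Proof.
apply: fpsP => n; rewrite /fpsD fpsED !fpsEM mulr_sumr -big_split /=.
apply: eq_bigr => i _; have ni : (i <= n)%N by rewrite -ltnS.
by rewrite -[X in X%:R](subnKC ni) natrD; ring.
Qed.

Lemma fpsDC c : fpsD (fpsC c) = 0.
Proof. by apply: fpsP => -[|n]; rewrite /fpsD ?mul0r ?mulr0. Qed.

Lemma fpsDX : fpsD fpsX = fpsX.
Proof.
by apply: fpsP => n; rewrite /fpsD /fpsX; case: eqP => [->|]; rewrite ?mul1r ?mulr0.
Qed.

(** ** Composition *)

Lemma fps_expr_lt g k n : g 0%N = 0 -> (n < k)%N -> (g ^+ k) n = 0.
Proof.
move=> g0; elim: k n => // k IH n nk; rewrite exprS fpsEM big1 // => -[[|i] /= ni] _.
  by rewrite g0 mul0r.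
rewrite !ltnS in nk ni; rewrite IH ?mulr0 // (leq_trans _ nk) //.
by rewrite ltn_subrL /= (leq_trans _ ni).
Qed.

(** For g without constant term, truncating the sum at k = n loses nothing. *)
Definition fps_comp f g : fps K := fun n => \sum_(k < n.+1) f k * (g ^+ k) n.

Definition fps_shift f : fps K := fun n => f n.+1.

Lemma fps_shiftE f : f = fpsC (f 0%N) + fpsX * fps_shift f.
Proof.
by apply: fpsP => -[|n]; rewrite fpsED fpsEXM /= ?addr0 ?add0r.
Qed.

Lemma fps_comp_widen f g n N : g 0%N = 0 -> (n < N)%N ->
  fps_comp f g n = \sum_(k < N) f k * (g ^+ k) n.
Proof.
move=> g0 nN; rewrite /fps_comp (big_ord_widen N (fun k => f k * (g ^+ k) n)) //.
rewrite big_mkcond /=; apply: eq_bigr => i _; case: ltnP => // ni.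
by rewrite fps_expr_lt // mulr0.
Qed.

Lemma fps_comp_rec f g : g 0%N = 0 ->
  fps_comp f g = fpsC (f 0%N) + g * fps_comp (fps_shift f) g.
Proof.
move=> g0; apply: fpsP => n; rewrite fpsED (@fps_comp_widen _ _ _ n.+2) //.
rewrite big_ord_recl; congr (_ + _).
  by rewrite expr0 fpsE1; case: n => [|n]; rewrite ?mulr1 ?mulr0.
rewrite fpsEM.
under [RHS]eq_bigr => i _.
  rewrite (@fps_comp_widen _ _ _ n.+1) ?ltnS ?leq_subr // mulr_sumr; over.
rewrite exchange_big /=; apply: eq_bigr => k _; rewrite exprS fpsEM mulr_sumr.
by apply: eq_bigr => i _; rewrite mulrCA.
Qed.

(** A recursion through multiplication by g determines its solutions when g has
    no constant term; the identities on compositions below are all obtained by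
    checking that both sides obey the same recursion. *)
Lemma fps_rec_eq0 (A : Type) (s : A -> A) (F : A -> fps K) g : g 0%N = 0 ->
  (forall a, F a = g * F (s a)) -> forall a, F a = 0.
Proof.
move=> g0 FE a; apply: fpsP => n; rewrite fpsE0; elim/ltn_ind: n a => n IH a.
rewrite FE fpsEM big1 // => -[[|i] /= ni] _; first by rewrite g0 mul0r.
by rewrite ltnS in ni; rewrite IH ?mulr0 // ltn_subrL /= (leq_trans _ ni).
Qed.

Lemma fps_compD f1 f2 g : fps_comp (f1 + f2) g = fps_comp f1 g + fps_comp f2 g.
Proof.
apply: fpsP => n; rewrite fpsED /fps_comp -big_split; apply: eq_bigr => k _.
by rewrite fpsED mulrDl.
Qed.

Lemma fps_compN f g : fps_comp (- f) g = - fps_comp f g.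
Proof.
apply: fpsP => n; rewrite fpsEN /fps_comp -sumrN; apply: eq_bigr => k _.
by rewrite fpsEN mulNr.
Qed.

Lemma fps_compCM c f g : fps_comp (fpsC c * f) g = fpsC c * fps_comp f g.
Proof.
apply: fpsP => n; rewrite fpsECM /fps_comp mulr_sumr; apply: eq_bigr => k _.
by rewrite fpsECM mulrA.
Qed.

Lemma fps_compXM f g : g 0%N = 0 -> fps_comp (fpsX * f) g = g * fps_comp f g.
Proof.
move=> g0; rewrite fps_comp_rec // fpsEXM fpsC0 add0r; congr (_ * fps_comp _ _).
by apply: fpsP => n; rewrite /fps_shift fpsEXM.
Qed.

Lemma fps_compM f1 f2 g : g 0%N = 0 ->
  fps_comp (f1 * f2) g = fps_comp f1 g * fps_comp f2 g.
Proof.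
move=> g0; apply/eqP; rewrite -subr_eq0; apply/eqP; move: f1.
apply: (fps_rec_eq0 (s := fps_shift) g0) => f1.
rewrite {1}[f1]fps_shiftE mulrDl fps_compD fps_compCM -mulrA fps_compXM //.
by rewrite (@fps_comp_rec f1) //; ring.
Qed.

Lemma fps_compX f : fps_comp f fpsX = f.
Proof.
apply/eqP; rewrite -subr_eq0; apply/eqP; move: f.
apply: (fps_rec_eq0 (s := fps_shift) (g := fpsX) erefl) => f.
by rewrite [X in _ - X = _]fps_shiftE fps_comp_rec //; ring.
Qed.

(** The chain rule; it is multiplied by g because composing with the Euler
    operator gives the logarithmic derivative of g. *)
Lemma fpsD_comp f g : g 0%N = 0 ->
  g * fpsD (fps_comp f g) = fps_comp (fpsD f) g * fpsD g.
Proof.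
move=> g0; apply/eqP; rewrite -subr_eq0; apply/eqP; move: f.
apply: (fps_rec_eq0 (s := fps_shift) g0) => f.
rewrite {2}[f]fps_shiftE !fpsDD fpsDC add0r fpsDM fpsDX fps_compD !fps_compXM //.
by rewrite fps_comp_rec // fpsDD fpsDC add0r fpsDM; ring.
Qed.

End FormalPowerSeries.

(** * Real-rootedness *)

Section HalfPlane.
Variable C : numClosedFieldType.
Implicit Types (F q : {poly C}) (b w z : C) (d k : nat) (s : seq C).

Lemma ltr_sum_seq s (f g : C -> C) : s != [::] ->
  (forall a, a \in s -> f a < g a) -> \sum_(a <- s) f a < \sum_(a <- s) g a.
Proof.
case: s => // a s _ fg; rewrite !big_cons ltr_leD ?fg ?mem_head //.
by rewrite !(big_seq _ _ s) ler_sum // => b bs; rewrite ltW // fg // inE bs orbT.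
Qed.

Definition lower_rooted d F :=
  size F = d.+1 /\ forall z, root F z -> 'Im z < 0.

(** Grace's apolar invariant of F(x) and q(-x), in terms of coefficients. *)
Definition apolar d F q : C :=
  \sum_(k < d.+1) F`_k * q`_(d - k) / 'C(d, k)%:R.

(** The polar derivative of F with respect to the pole -b. *)
Definition polar_deriv d b F : {poly C} := F *+ d - ('X + b%:P) * F^`().

Lemma coef_polar_deriv d b F k :
  (polar_deriv d b F)`_k = F`_k *+ d - F`_k *+ k - b * F`_k.+1 *+ k.+1.
Proof.
rewrite coefB coefMn mulrDl coefD coefXM coefCM !coef_deriv.
by case: k => [|k] /=; ring.
Qed.

Lemma horner_deriv_prod_XsubC s w : w \notin s ->
  (\prod_(a <- s) ('X - a%:P))^`().[w] =
  (\prod_(a <- s) ('X - a%:P)).[w] * \sum_(a <- s) (w - a)^-1.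
Proof.
elim: s => [|a s IH]; first by rewrite !big_nil derivC horner0 mulr0.
rewrite inE negb_or => /andP[wa ws]; rewrite !big_cons derivM derivXsubC mul1r.
rewrite hornerD !hornerM hornerXsubC IH //.
by field; rewrite subr_eq0.
Qed.

Lemma lower_rooted_factor d F : lower_rooted d F ->
  exists2 s : seq C, size s = d /\ (forall a, a \in s -> 'Im a < 0) &
    F = lead_coef F *: \prod_(a <- s) ('X - a%:P).
Proof.
move=> [sF rF]; have [s Fs] := closed_field_poly_normal F.
have F0 : lead_coef F != 0 by rewrite lead_coef_eq0 -size_poly_eq0 sF.
exists s => //; split => [|a ain].
  by apply: succn_inj; rewrite -sF Fs size_scale // size_prod_XsubC.
by apply: rF; rewrite Fs rootZ // root_prod_XsubC.
Qed.

(** Laguerre's theorem for the half-plane: if w were a root with Im w >= 0, then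
    1/(w + b) would be the mean of the numbers u = 1/(w - a), for a a root of F,
    all of which satisfy Im u < - Im w |u|^2, a convex condition violated by
    1/(w + b). *)
Lemma polar_deriv_root d b F w : lower_rooted d.+1 F -> b \is Num.real ->
  root (polar_deriv d.+1 b F) w -> 'Im w < 0.
Proof.
move=> lF bR /rootP; have [s [ss sl] Fs] := lower_rooted_factor lF.
have F0 : lead_coef F != 0 by rewrite lead_coef_eq0 -size_poly_eq0 lF.1.
rewrite real_ltNge ?Creal_Im ?real0 // => rw; apply/negP => w0.
have ws : w \notin s by apply/negP => /sl wl; rewrite (lt_geF wl) in w0.
move: rw; rewrite /polar_deriv Fs derivZ hornerD hornerN hornerM.
rewrite [('X + _).[_]]hornerD hornerX hornerC.
rewrite hornerMn !hornerZ horner_deriv_prod_XsubC //.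
set pw := _.[w]; have pw0 : pw != 0 by rewrite -/(root _ _) root_prod_XsubC.
set S := \sum_(a <- s) _ => rw.
have {}rw : d.+1%:R = (w + b) * S.
  apply: (mulfI (mulf_neq0 F0 pw0)); apply/eqP; rewrite -subr_eq0 -rw.
  by apply/eqP; ring.
have wb0 : w + b != 0.
  by apply/eqP => wb; move/eqP: rw; rewrite wb mul0r pnatr_eq0.
pose v := (w + b)^-1.
have Sv : S = d.+1%:R * v by rewrite rw mulrAC /v divff // mul1r.
have Imv : 'Im v = - 'Im w * `|v| ^+ 2.
  by rewrite ImV /v normfV exprVn raddfD /= (Creal_ImP _ bR) addr0.
have ImS : 'Im S < - 'Im w * \sum_(a <- s) `|(w - a)^-1| ^+ 2.
  rewrite raddf_sum /= mulr_sumr.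
  apply: ltr_sum_seq => [|a ain]; first by rewrite -size_eq0 ss.
  rewrite ImV normfV exprVn ltr_pM2r.
    by rewrite raddfB /= ltrN2 ltrBrDl gtrDr sl.
  rewrite invr_gt0 exprn_gt0 // normr_gt0 subr_eq0.
  by apply: contraNneq ws => ->.
have sumsq : d.+1%:R * `|v| ^+ 2 <= \sum_(a <- s) `|(w - a)^-1| ^+ 2.
  rewrite -subr_ge0.
  have -> : \sum_(a <- s) `|(w - a)^-1| ^+ 2 - d.+1%:R * `|v| ^+ 2 =
      \sum_(a <- s) `|(w - a)^-1 - v| ^+ 2.
    transitivity (\sum_(a <- s) (`|(w - a)^-1| ^+ 2 + `|v| ^+ 2
        - (w - a)^-1 * v^* - ((w - a)^-1)^* * v)).
      rewrite !sumrB big_split /=.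
      have -> : \sum_(a <- s) `|v| ^+ 2 = d.+1%:R * `|v| ^+ 2.
        by rewrite big_const_seq count_predT ss iter_addr_0 mulr_natl.
      rewrite -!mulr_suml -/S -rmorph_sum /= -/S Sv.
      by rewrite rmorphM /= rmorph_nat !normCK; ring.
    by apply: eq_bigr => a _; rewrite !normCK rmorphB /=; ring.
  by apply: sumr_ge0 => a _; rewrite exprn_ge0.
have : 'Im S < 'Im S.
  apply: (lt_le_trans ImS); rewrite Sv ImM (Creal_ImP _ (realn C d.+1)) mulr0 addr0.
  rewrite (Creal_ReP _ (realn C d.+1)) Imv mulrCA ler_wnM2l // oppr_le0 //.
by rewrite ltxx.
Qed.

(** The degree drops by exactly one: the coefficient of degree d is a nonzero
    multiple of the sum of the a + b over the roots a of F, which has a negative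
    imaginary part. *)
Lemma polar_deriv_lower d b F : lower_rooted d.+1 F -> b \is Num.real ->
  lower_rooted d (polar_deriv d.+1 b F).
Proof.
move=> lF bR; split=> [|w]; last exact: polar_deriv_root lF bR.
have [s [ss sl] Fs] := lower_rooted_factor lF.
have F0 : lead_coef F != 0 by rewrite lead_coef_eq0 -size_poly_eq0 lF.1.
apply/eqP; rewrite eqn_leq; apply/andP; split.
  apply/leq_sizeP => k; rewrite leq_eqVlt => /orP[/eqP<-|dk]; rewrite coef_polar_deriv.
    by rewrite subrr sub0r [F`_d.+2]nth_default ?lF.1 // mulr0 mul0rn oppr0.
  by rewrite !nth_default ?lF.1 // ?mulr0 ?mul0rn ?subrr // leqW.
rewrite ltnNge; apply/negP => /leq_sizeP/(_ d (leqnn d)).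
rewrite coef_polar_deriv -mulrnBr ?leqnSn // subSnn.
have Fd1 : F`_d.+1 = lead_coef F by rewrite lead_coefE lF.1.
have Fd : F`_d = - lead_coef F * \sum_(a <- s) a.
  rewrite {1}Fs coefZ; have := coefPn_prod_XsubC (ps := s); rewrite ss => /(_ isT) ->.
  by rewrite mulrN mulNr.
rewrite Fd1 Fd mulr1n => eq0.
have {eq0} : \sum_(a <- s) (a + b) = 0.
  rewrite big_split /= big_const_seq count_predT ss iter_addr_0.
  apply: (mulfI F0); rewrite mulr0 -[RHS]oppr0 -[X in _ = - X]eq0 mulrDr.
  by ring.
move/(congr1 (fun z => 'Im z)); rewrite raddf_sum /= raddf0; apply/eqP.
rewrite lt_eqF // -[ltRHS](@big1_eq _ _ +%R _ s predT).
apply: ltr_sum_seq => [|a ain]; first by rewrite -size_eq0 ss.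
by rewrite raddfD /= (Creal_ImP _ bR) addr0 sl.
Qed.

(** Both ratios of binomial coefficients that come out of the two terms of
    X - b are affine in k, which makes the right-hand side a differential
    operator of order one in F. *)
Lemma apolar_cons d b F q : size q = d.+1 -> size F = d.+2 ->
  apolar d.+1 F (('X - b%:P) * q) = d.+1%:R^-1 * apolar d (polar_deriv d.+1 b F) q.
Proof.
move=> sq sF; rewrite /apolar mulr_sumr.
transitivity (\sum_(k < d.+1) F`_k * q`_(d - k) / 'C(d.+1, k)%:R -
              \sum_(k < d.+1) b * F`_k.+1 * q`_(d - k) / 'C(d.+1, k.+1)%:R).
  have -> : \sum_(k < d.+2) F`_k * (('X - b%:P) * q)`_(d.+1 - k) / 'C(d.+1, k)%:R =
    \sum_(k < d.+2) F`_k * (if (d.+1 - k == 0)%N then 0 else q`_(d.+1 - k).-1)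
       / 'C(d.+1, k)%:R -
    \sum_(k < d.+2) b * F`_k * q`_(d.+1 - k) / 'C(d.+1, k)%:R.
    rewrite -sumrB; apply: eq_bigr => k _.
    by rewrite mulrBl coefB coefXM coefCM; case: eqP => _; ring.
  congr (_ - _).
    rewrite big_ord_recr /= subnn eqxx mulr0 mul0r addr0; apply: eq_bigr => k _.
    by rewrite subn_eq0 leqNgt ltnS -ltnS ltn_ord /= subSn //= -ltnS.
  rewrite big_ord_recl subn0 [q`__]nth_default ?sq // mulr0 mul0r add0r.
  by apply: eq_bigr => k _; rewrite subSS.
rewrite -sumrB; apply: eq_bigr => -[k /= kd] _; rewrite coef_polar_deriv.
have d0 : d.+1%:R != 0 :> C by rewrite pnatr_eq0.
have k0 : k.+1%:R != 0 :> C by rewrite pnatr_eq0.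
have dk : d.+1%:R - k%:R != 0 :> C.
  by rewrite -natrB ?leqW // pnatr_eq0 subn_eq0 -ltnNge.
have C0 : 'C(d, k)%:R != 0 :> C by rewrite pnatr_eq0 -lt0n bin_gt0.
have -> : 'C(d.+1, k)%:R = d.+1%:R * 'C(d, k)%:R / (d.+1%:R - k%:R) :> C.
  apply: (mulIf dk); rewrite divfK // -natrB ?leqW // -!natrM.
  by rewrite mulnC -mul_bin_down.
have -> : 'C(d.+1, k.+1)%:R = d.+1%:R * 'C(d, k)%:R / k.+1%:R :> C.
  by apply: (mulIf k0); rewrite divfK // -!natrM mulnC -mul_bin_diag.
field.
by rewrite !nat1r d0 k0 dk C0.
Qed.

(** Grace's theorem in a half-plane, by induction on the degree: each real root
    b of the second polynomial is traded for a polar derivative of the first. *)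
Lemma apolar_neq0 d F s : lower_rooted d F -> size s = d ->
  (forall b, b \in s -> b \is Num.real) ->
  apolar d F (\prod_(b <- s) ('X - b%:P)) != 0.
Proof.
elim: d F s => [|d IH] F [|b s] // lF.
  move=> _ _; rewrite big_nil /apolar big_ord1 bin0 divr1 coefC mulr1.
  have : lead_coef F != 0 by rewrite lead_coef_eq0 -size_poly_eq0 lF.1.
  by rewrite lead_coefE lF.1.
move=> [ss] sR; rewrite big_cons apolar_cons ?lF.1 ?size_prod_XsubC ?ss //.
rewrite mulf_neq0 ?invr_eq0 ?pnatr_eq0 //; apply: IH => //.
  by apply: polar_deriv_lower => //; apply: sR; rewrite mem_head.
by move=> c cs; apply: sR; rewrite inE cs orbT.
Qed.

End HalfPlane.

Section RealRooted.
Variable R : realType.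
Implicit Types (p q f : {poly R}).
Local Notation toC := (map_poly (real_complex R)).

Lemma bin_mul_bin d n i : (i <= n)%N -> (n <= d)%N ->
  ('C(d, n) * 'C(n, i) = 'C(d, i) * 'C(d - i, n - i))%N.
Proof.
move=> ni nd; have id : (i <= d)%N by exact: leq_trans nd.
have nid : (n - i <= d - i)%N by rewrite leq_sub2r.
have : (0 < i`! * (n - i)`! * (d - n)`!)%N by rewrite !muln_gt0 !fact_gt0.
move=> /eqn_pmul2r eqM; apply/eqP; rewrite -eqM; apply/eqP.
transitivity (d`!).
  by rewrite -(bin_fact nd) -(bin_fact ni); ring.
have -> : (d - n = d - i - (n - i))%N by rewrite subnBA // subnK.
by rewrite -(bin_fact id) -(bin_fact nid); ring.
Qed.

(** The binomial weights here are those of the divided derivatives of p, whence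
    ffconv_nderivn and the power series form of the convolution. *)
Lemma coef_ffconv d p q n : (n <= d)%N ->
  (ffconv d p q)`_(d - n) =
  \sum_(k < n.+1)
    q`_(d - k) * p`_(d - (n - k)) * 'C(d - (n - k), k)%:R / 'C(d, k)%:R.
Proof.
move=> nd; rewrite coef_sum (bigD1 (Ordinal (nd : n < d.+1)%N)) //=.
rewrite [X in _ + X]big1 ?addr0 => [|k kn]; last first.
  rewrite coefZ coefXn; case: eqP => [e|]; last by rewrite mulr0.
  case/eqP: kn; apply: val_inj => /=; rewrite -(subKn nd) e subKn //.
  by rewrite -ltnS.
rewrite coefZ coefXn eqxx mulr1 (reindex_inj rev_ord_inj) mulr_sumr /=.
apply: eq_bigr => -[k /= kn] _; rewrite subSS; rewrite ltnS in kn.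
have kd := leq_trans kn nd; rewrite subKn // /ffcoef.
have nkd : (n - k <= d)%N by rewrite (leq_trans (leq_subr _ _)).
have C1 : 'C(d, k)%:R != 0 :> R by rewrite pnatr_eq0 -lt0n bin_gt0.
have C2 : 'C(d, n - k)%:R != 0 :> R by rewrite pnatr_eq0 -lt0n bin_gt0.
have : 'C(d, n)%:R * 'C(n, n - k)%:R = 'C(d, n - k)%:R * 'C(d - (n - k), k)%:R :> R.
  by rewrite -!natrM bin_mul_bin ?leq_subr // subKn.
have -> : (-1) ^+ n = (-1) ^+ k * (-1) ^+ (n - k) :> R by rewrite -exprD subnKC.
move=> CE.
transitivity ((-1) ^+ k * (-1) ^+ k * ((-1) ^+ (n - k) * (-1) ^+ (n - k)) *
   ('C(d, n)%:R * 'C(n, n - k)%:R) * p`_(d - (n - k)) * q`_(d - k)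
    / 'C(d, n - k)%:R / 'C(d, k)%:R :> R).
  by field; rewrite C1 C2.
rewrite CE -!expr2 !sqrr_sign; field; by rewrite C1 C2.
Qed.

Lemma size_ffconv_le d p q : (size (ffconv d p q) <= d.+1)%N.
Proof.
apply/leq_sizeP => j dj; rewrite coef_sum big1 // => k _; rewrite coefZ coefXn.
by rewrite gtn_eqF ?mulr0 // (leq_ltn_trans (leq_subr _ _)).
Qed.

Lemma lead_ffconv d p q : size p = d.+1 -> size q = d.+1 ->
  p \is monic -> q \is monic -> (ffconv d p q)`_d = 1.
Proof.
move=> sp sq /monicP p1 /monicP q1; have := @coef_ffconv d p q 0 isT.
rewrite subn0 => ->; rewrite big_ord1 /= subn0 !bin0 divr1 mulr1.
by move: p1 q1; rewrite !lead_coefE sp sq /= => -> ->; rewrite mulr1.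
Qed.

Lemma ffconv_nderivn d p q : size p = d.+1 ->
  ffconv d p q = \sum_(k < d.+1) (q`_(d - k) / 'C(d, k)%:R) *: p^`N(k).
Proof.
move=> sp; apply/polyP => j; have [jd|dj] := leqP j d; last first.
  rewrite nth_default ?(leq_trans (size_ffconv_le _ _ _)) // coef_sum big1 // => k _.
  by rewrite coefZ coef_nderivn [p`__]nth_default ?mul0rn ?mulr0 // sp ltn_addl.
rewrite -(subKn jd) coef_ffconv ?leq_subr //; set n := (d - j)%N.
have nd : (n <= d)%N by exact: leq_subr.
rewrite coef_sum (big_ord_widen d.+1 (fun k => q`_(d - k) * p`_(d - (n - k))
  * 'C(d - (n - k), k)%:R / 'C(d, k)%:R)) // big_mkcond /=.
apply: eq_bigr => k _; rewrite coefZ coef_nderivn; case: ltnP => kn.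
  by rewrite subnBA // addnC addnBA // addnC -mulr_natr; ring.
by rewrite [p`__]nth_default ?mul0rn ?mulr0 // sp; move: kn nd; lia.
Qed.

(** The value of the convolution at z is the apolar form of p(z + x) and q; when
    Im z > 0, the roots of p(z + x) lie in the open lower half-plane and
    apolar_neq0 applies. *)
Lemma real_rooted_ffconv_root d p q (z : R[i]) :
  real_rooted d p -> real_rooted d q -> root (toC (ffconv d p q)) z ->
  ~ 0 < 'Im z.
Proof.
move=> [p1 sp [s ps]] [_ sq [t qt]] rz z0.
pose F : {poly R[i]} := \poly_(k < d.+1) (toC p)^`N(k).[z].
have FE h : F.[h] = (toC p).[z + h].
  rewrite horner_poly nderiv_taylor ?size_map_poly ?sp //; exact: mulrC.
have pE : toC p = \prod_(a <- s) ('X - (real_complex R a)%:P).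
  by rewrite ps rmorph_prod; apply: eq_bigr => a _; rewrite /= map_polyXsubC.
have qE : toC q = \prod_(a <- [seq real_complex R a | a <- t]) ('X - a%:P).
  by rewrite qt rmorph_prod big_map; apply: eq_bigr => a _; rewrite /= map_polyXsubC.
have CR (a : R) : real_complex R a \is Num.real by apply/complex_realP; exists a.
have sF : size F = d.+1.
  rewrite size_poly_eq // nderivn_map.
  have -> : p^`N(d) = (p`_d)%:P.
    apply/polyP => -[|i]; rewrite coef_nderivn coefC /= ?addn0 ?binn //.
    by rewrite nth_default ?mul0rn // sp addnS ltnS leq_addr.
  rewrite map_polyC hornerC fmorph_eq0.
  by have /monicP := p1; rewrite lead_coefE sp /= => ->; rewrite oner_eq0.
have lF : lower_rooted d F.
  split=> // h /rootP; rewrite FE => /rootP; rewrite pE.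
  rewrite -(big_map (real_complex R) predT (fun a => 'X - a%:P)) root_prod_XsubC.
  move=> /mapP[a _] e; have -> : h = real_complex R a - z by rewrite -e addrC addKr.
  by rewrite raddfB /= (Creal_ImP _ (CR a)) sub0r oppr_lt0.
have := @apolar_neq0 _ d F [seq real_complex R a | a <- t] lF.
rewrite size_map; move: sq; rewrite qt size_prod_XsubC => -[->] /(_ erefl).
rewrite -qE => H; have /eqP : apolar d F (toC q) != 0.
  by apply: H => b /mapP[a _ ->]; exact: CR.
apply; move/rootP: rz; rewrite ffconv_nderivn // rmorph_sum horner_sum => <-.
apply: eq_bigr => k _; rewrite /= linearZ /= hornerZ coef_poly ltn_ord.
rewrite nderivn_map coef_map rmorphM fmorphV /= rmorph_nat.
by ring.
Qed.

Lemma real_rooted_of_roots d f : f \is monic -> size f = d.+1 ->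
  (forall z : R[i], root (toC f) z -> ~ 0 < 'Im z) -> real_rooted d f.
Proof.
move=> f1 sf fr; split => //.
have realr z : root (toC f) z -> z \is Num.real.
  move=> rz; apply/Creal_ImP; apply/eqP; rewrite eq_le.
  rewrite !real_leNgt ?Creal_Im ?real0 //; apply/andP.
  split; apply/negP; first exact: fr.
  rewrite -oppr_gt0 -Im_conj; apply: fr.
  have <- : map_poly Num.conj (toC f) = toC f.
    rewrite -map_poly_comp; apply: eq_map_poly => a /=.
    by apply/CrealP/complex_realP; exists a.
  exact: rmorph_root.
have [s sE] := closed_field_poly_normal (toC f).
have /monicP l1 : toC f \is monic by rewrite map_monic.
exists [seq complex.Re z | z <- s].
apply: (@map_poly_inj _ _ (real_complex R)); rewrite sE l1 scale1r rmorph_prod big_map.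
rewrite !big_seq; apply: eq_bigr => z zs; rewrite /= map_polyXsubC.
congr ('X - _%:P); apply/esym/RRe_real/realr.
by rewrite sE l1 scale1r root_prod_XsubC.
Qed.

Lemma real_rooted_ffconv d p q :
  real_rooted d p -> real_rooted d q -> real_rooted d (ffconv d p q).
Proof.
move=> pr qr; have [p1 sp _] := pr; have [q1 sq _] := qr.
have l1 := lead_ffconv sp sq p1 q1.
have sz : size (ffconv d p q) = d.+1.
  apply/eqP; rewrite eqn_leq size_ffconv_le /= ltnNge; apply/negP.
  by move=> /leq_sizeP/(_ d (leqnn d))/eqP; rewrite l1 oner_eq0.
apply: real_rooted_of_roots => //; first by rewrite monicE lead_coefE sz l1.
by move=> z; apply: real_rooted_ffconv_root.
Qed.

End RealRooted.

(** * Non-crossing partitions of a set of indices *)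

Local Notation pblock := finset.pblock.

Section NoncrossingSets.
Context {N : nat}.
Implicit Types (S A B V W : {set 'I_N}) (P Q : {set {set 'I_N}}) (x j : 'I_N).

Definition ncp S : {set {set {set 'I_N}}} :=
  [set P | finset.partition P S & noncrossing P].

Definition is_partition P S :=
  [/\ forall V, V \in P -> exists x, x \in V,
      forall V x, V \in P -> x \in V -> x \in S,
      forall x, x \in S -> exists2 V, V \in P & x \in V &
      forall V W x, V \in P -> W \in P -> x \in V -> x \in W -> V = W].

Definition is_noncrossing P := forall V W (a b c d : 'I_N),
  V \in P -> W \in P -> a \in V -> b \in W -> c \in V -> d \in W ->
  (a < b)%N -> (b < c)%N -> (c < d)%N -> V = W.

Lemma partition_elementP P S : reflect (is_partition P S) (finset.partition P S).
Proof.
apply: (iffP and3P) => [[/eqP cov triv P0]|[ne sub cov uniq]].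
  split=> [V VP|V x VP xV|x|V W x VP WP xV xW].
  - by apply/finset.set0Pn; apply: contraNneq P0 => <-.
  - by rewrite -cov; apply/finset.bigcupP; exists V.
  - by rewrite -cov => /finset.bigcupP[V VP xV]; exists V.
  - by rewrite -(finset.def_pblock triv VP xV) (finset.def_pblock triv WP xW).
split.
- apply/eqP/finset.setP => x; apply/finset.bigcupP/idP => [[V VP]|/cov[V VP xV]].
    exact: sub.
  by exists V.
- apply/finset.trivIsetP => V W VP WP; apply: contraNT.
  rewrite -finset.setI_eq0 => /finset.set0Pn[x]; rewrite inE => /andP[xV xW].
  by apply/eqP; exact: uniq xV xW.
- by apply/negP => /ne[x]; rewrite finset.in_set0.
Qed.

Lemma noncrossingP P : reflect (is_noncrossing P) (noncrossing P).
Proof.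
apply: (iffP forall_inP) => [H V W a b c d VP WP aV bW cV dW ab bc cd|H V VP].
  apply/eqP; apply: contraT => VW.
  have /forall_inP/(_ W WP) := H V VP; rewrite VW /= => /negP[].
  apply/exists_inP; exists a => //; apply/exists_inP; exists b => //.
  apply/exists_inP; exists c => //; apply/exists_inP; exists d => //.
  by rewrite ab bc cd.
apply/forall_inP => W WP; apply/implyP => VW; apply: contra VW.
move=> /exists_inP[a aV] /exists_inP[b bW] /exists_inP[c cV] /exists_inP[d dW].
by move=> /and3P[ab bc cd]; apply/eqP; exact: (H V W a b c d).
Qed.

Lemma ncpP P S : reflect (is_partition P S /\ is_noncrossing P) (P \in ncp S).
Proof.
rewrite inE; apply: (iffP andP) => -[/partition_elementP pP /noncrossingP nP] //.
Qed.

Lemma pblockE P S V x : is_partition P S -> V \in P -> x \in V -> pblock P x = V.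
Proof.
by move=> /partition_elementP/and3P[_ triv _]; exact: finset.def_pblock.
Qed.

Lemma pblock_ex P S x : is_partition P S -> x \in S ->
  pblock P x \in P /\ x \in pblock P x.
Proof.
move=> pP; have [_ _ cov _] := pP => /cov[V VP xV].
by rewrite (pblockE pP VP xV).
Qed.

Lemma ncp0 : ncp finset.set0 = [set finset.set0].
Proof.
apply/finset.setP => P; rewrite finset.in_set1; apply/ncpP/eqP => [[[ne sub _ _] _]|->].
  apply/finset.setP => V; rewrite finset.in_set0; apply/negP => VP.
  by have [x xV] := ne _ VP; have := sub _ _ VP xV; rewrite finset.in_set0.
split; first split.
- by move=> V; rewrite finset.in_set0.
- by move=> V x; rewrite finset.in_set0.
- by move=> x; rewrite finset.in_set0.
- by move=> V W x; rewrite finset.in_set0.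
- by move=> V W a b c d; rewrite finset.in_set0.
Qed.

Lemma ncp1 x : ncp [set x] = [set [set [set x]]].
Proof.
apply/finset.setP => P; rewrite finset.in_set1; apply/ncpP/eqP => [[[ne sub cov _] _]|->].
  have eqx V : V \in P -> V = [set x].
    move=> VP; apply/finset.setP => y; rewrite finset.in_set1; apply/idP/eqP => [yV|->].
      by have := sub _ _ VP yV; rewrite finset.in_set1 => /eqP.
    by have [z zV] := ne _ VP; have := sub _ _ VP zV; rewrite finset.in_set1 => /eqP <-.
  have [V VP _] := cov x (finset.set11 x).
  apply/finset.setP => W; rewrite finset.in_set1; apply/idP/eqP => [/eqx//|->].
  by rewrite -(eqx _ VP).
split; first split.
- by move=> V /finset.set1P ->; exists x; exact: finset.set11.
- by move=> V y /finset.set1P ->.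
- by move=> y yx; exists [set x] => //; exact: finset.set11.
- by move=> V W y /finset.set1P -> /finset.set1P ->.
- by move=> V W a b c d /finset.set1P -> /finset.set1P ->.
Qed.

Lemma ncp_sub_blocks P S A : P \in ncp S -> A \subset S ->
  (forall V x, V \in P -> x \in V -> x \in A -> V \subset A) ->
  P ::&: A \in ncp A.
Proof.
move=> /ncpP[[ne sub cov uniq] nc] /fintype.subsetP AS blk; apply/ncpP.
split; first split.
- by move=> V; rewrite inE => /andP[/ne].
- by move=> V x; rewrite inE => /andP[_ /fintype.subsetP]; apply.
- move=> x xA; have [V VP xV] := cov _ (AS _ xA).
  by exists V => //; rewrite inE VP (blk _ x).
- by move=> V W x; rewrite !inE => /andP[VP _] /andP[WP _]; exact: uniq.
- by move=> V W a b c d; rewrite !inE => /andP[VP _] /andP[WP _]; exact: nc.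
Qed.

Definition below S j := [set i in S | (i < j)%N].
Definition upto S j := [set i in S | (i <= j)%N].
Definition above S j := [set i in S | (j < i)%N].

Definition is_last P x j := (j \in pblock P x) && [forall i in pblock P x, (i <= j)%N].

(** When j is the last element of the block of the minimum x, a block with
    elements on both sides of j would cross that block. *)
Lemma ncp_split P S x j : P \in ncp S -> x \in S ->
  (forall i, i \in S -> (x <= i)%N) -> is_last P x j ->
  [/\ P ::&: upto S j \in ncp (upto S j), P ::&: above S j \in ncp (above S j),
      pblock (P ::&: upto S j) x = pblock P x &
      P = (P ::&: upto S j) :|: (P ::&: above S j)].
Proof.
move=> Pncp xS xmin /andP[jV /forall_inP lastj].
have [pP nc] := ncpP _ _ Pncp; have [ne sub cov uniq] := pP.
have [VP xV] := pblock_ex pP xS.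
have sideP W : W \in P -> W \subset upto S j \/ W \subset above S j.
  move=> WP; have [->|WV] := eqVneq W (pblock P x).
    by left; apply/fintype.subsetP => i iV; rewrite inE (sub _ _ VP iV) lastj.
  have [W_le|] := boolP [forall i in W, (i <= j)%N].
    left; apply/fintype.subsetP => i iW; rewrite inE (sub _ _ WP iW) /=.
    exact: (forall_inP W_le).
  rewrite negb_forall_in => /exists_inP[d dW]; rewrite -ltnNge => jd; right.
  apply/fintype.subsetP => a aW; rewrite inE (sub _ _ WP aW) /= ltnNge.
  apply/negP; rewrite leq_eqVlt => /orP[/eqP/val_inj aj|aj].
    by move/eqP: WV; apply; apply: (uniq _ _ a) => //; rewrite aj.
  have := xmin _ (sub _ _ WP aW); rewrite leq_eqVlt => /orP[/eqP/val_inj xa|xa].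
    by move/eqP: WV; apply; apply: (uniq _ _ a) => //; rewrite -xa.
  by move/eqP: WV; apply; apply/esym; exact: (nc _ _ x a j d).
have excl W i : i \in W -> i \in upto S j -> W \subset above S j -> False.
  move=> iW; rewrite inE => /andP[_ ij] /fintype.subsetP/(_ _ iW).
  by rewrite inE ltnNge ij andbF.
have excl' W i : i \in W -> i \in above S j -> W \subset upto S j -> False.
  move=> iW; rewrite inE => /andP[_ ij] /fintype.subsetP/(_ _ iW).
  by rewrite inE leqNgt ij andbF.
have uncp : P ::&: upto S j \in ncp (upto S j).
  apply: (ncp_sub_blocks Pncp) => [|W i WP iW iA].
    by apply/fintype.subsetP => i; rewrite inE => /andP[].
  by have [//|/(excl _ _ iW iA)] := sideP _ WP.
split => //.
- apply: (ncp_sub_blocks Pncp) => [|W i WP iW iA].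
    by apply/fintype.subsetP => i; rewrite inE => /andP[].
  by have [/(excl' _ _ iW iA)|//] := sideP _ WP.
- have [pU _] := ncpP _ _ uncp; apply: (pblockE pU) => //.
  rewrite inE VP; apply/fintype.subsetP => i iV.
  by rewrite inE (sub _ _ VP iV) lastj.
- apply/finset.setP => W; rewrite !inE -andb_orr.
  apply/idP/andP => [WP|[]//]; split => //.
  by have [->|->] := sideP _ WP; rewrite ?orbT.
Qed.

Lemma ncp_union Q Q' S x j : x \in S -> j \in S ->
  (forall i, i \in S -> (x <= i)%N) ->
  Q \in ncp (upto S j) -> Q' \in ncp (above S j) -> j \in pblock Q x ->
  [/\ Q :|: Q' \in ncp S, pblock (Q :|: Q') x = pblock Q x,
      is_last (Q :|: Q') x j,
      (Q :|: Q') ::&: upto S j = Q & (Q :|: Q') ::&: above S j = Q'].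
Proof.
move=> xS jS xmin /ncpP[pQ ncQ] /ncpP[pQ' ncQ'] jV.
have [ne sub cov uniq] := pQ; have [ne' sub' cov' uniq'] := pQ'.
have subE V i : V \in Q -> i \in V -> (i \in S) && (i <= j)%N.
  by move=> VQ iV; have := sub _ _ VQ iV; rewrite inE.
have subE' V i : V \in Q' -> i \in V -> (i \in S) && (j < i)%N.
  by move=> VQ iV; have := sub' _ _ VQ iV; rewrite inE.
have xu : x \in upto S j by rewrite inE xS xmin.
have [VQ xV] := pblock_ex pQ xu.
have pU : is_partition (Q :|: Q') S.
  split.
  - by move=> V; rewrite inE => /orP[/ne|/ne'].
  - by move=> V i; rewrite inE => /orP[VP /(subE _ _ VP)/andP[]|VP /(subE' _ _ VP)/andP[]].
  - move=> i iS; have [ij|ij] := leqP i j.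
      have [|V VP iV] := cov i; first by rewrite inE iS.
      by exists V; rewrite // inE VP.
    have [|V VP iV] := cov' i; first by rewrite inE iS.
    by exists V; rewrite // inE VP orbT.
  - move=> V W i; rewrite !inE => /orP[VP|VP] /orP[WP|WP] iV iW.
    + exact: (uniq _ _ i).
    + have /andP[_ ij] := subE _ _ VP iV; have /andP[_] := subE' _ _ WP iW.
      by rewrite ltnNge ij.
    + have /andP[_ ij] := subE _ _ WP iW; have /andP[_] := subE' _ _ VP iV.
      by rewrite ltnNge ij.
    + exact: (uniq' _ _ i).
have pbE : pblock (Q :|: Q') x = pblock Q x.
  by apply: (pblockE pU) => //; rewrite inE VQ.
split => //.
- apply/ncpP; split => // V W a b c d; rewrite !inE.
  move=> /orP[VP|VP] /orP[WP|WP] aV bW cV dW ab bc cd.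
  + exact: (ncQ _ _ a b c d).
  + have /andP[_ ij] := subE _ _ VP cV; have /andP[_ ji] := subE' _ _ WP bW.
    by have := leq_ltn_trans ij (ltn_trans ji bc); rewrite ltnn.
  + have /andP[_ ij] := subE _ _ WP dW; have /andP[_ ji] := subE' _ _ VP cV.
    by have := leq_ltn_trans ij (ltn_trans ji cd); rewrite ltnn.
  + exact: (ncQ' _ _ a b c d).
- rewrite /is_last pbE jV; apply/forall_inP => i iV.
  by have /andP[] := subE _ _ VQ iV.
- apply/finset.setP => V; rewrite !inE; apply/andP/idP => [[/orP[//|VP]]|VP].
    have [i iV] := ne' _ VP => /fintype.subsetP/(_ _ iV); rewrite inE => /andP[_].
    by have /andP[_] := subE' _ _ VP iV; rewrite ltnNge => /negbTE ->.
  by split; [rewrite VP|apply/fintype.subsetP => i /(sub _ _ VP)].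
- apply/finset.setP => V; rewrite !inE; apply/andP/idP => [[/orP[VP|//]]|VP].
    have [i iV] := ne _ VP => /fintype.subsetP/(_ _ iV); rewrite inE => /andP[_].
    by have /andP[_] := subE _ _ VP iV; rewrite leqNgt => /negbTE ->.
  by split; [rewrite VP orbT|apply/fintype.subsetP => i /(sub' _ _ VP)].
Qed.

Definition block_add j x P := (j |: pblock P x) |: (P :\ pblock P x).
Definition block_del j x P := (pblock P x :\ j) |: (P :\ pblock P x).

(** Enlarging the block of the minimum x by an element j above all others creates
    no crossing: in a < b < c < d, the element j can only be d, and then x < a
    already gives a crossing with the old block. *)
Lemma block_addP P S x j :
  P \in ncp (below S j) -> x \in S -> j \in S -> (x < j)%N ->
  (forall i, i \in S -> (x <= i)%N) ->
  [/\ block_add j x P \in ncp (upto S j),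
      pblock (block_add j x P) x = j |: pblock P x &
      block_del j x (block_add j x P) = P].
Proof.
move=> /ncpP[pP nc] xS jS xj xmin; have [ne sub cov uniq] := pP.
have subE V i : V \in P -> i \in V -> (i \in S) && (i < j)%N.
  by move=> VQ iV; have := sub _ _ VQ iV; rewrite inE.
have [VP xV] : pblock P x \in P /\ x \in pblock P x.
  by apply: (pblock_ex pP); rewrite inE xS.
have jn V : V \in P -> j \notin V.
  by move=> /subE VE; apply/negP => /VE; rewrite ltnn andbF.
set V := pblock P x in VP xV *.
have addE W : W \in block_add j x P -> W = j |: V \/ W \in P /\ W != V.
  by rewrite !inE -/V => /orP[/eqP|/andP[]]; [left|right].
have disj W i : W \in P -> W != V -> i \in j |: V -> i \in W -> False.
  move=> WP WV; rewrite !inE => /orP[/eqP ->|iV] iW; first by have := jn _ WP; rewrite iW.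
  by move/eqP: WV; apply; exact: (uniq _ _ i).
have pA : is_partition (block_add j x P) (upto S j).
  split.
  - by move=> W /addE[->|[/ne//]]; exists x; rewrite !inE xV orbT.
  - move=> W i /addE[->|[WP _] /(subE _ _ WP)/andP[iS ij]]; rewrite !inE.
      move=> /orP[/eqP ->|/(subE _ _ VP)/andP[iS ij]]; first by rewrite jS leqnn.
      by rewrite iS (ltnW ij).
    by rewrite iS ltnW.
  - move=> i; rewrite inE => /andP[iS]; rewrite leq_eqVlt => /orP[/eqP/val_inj ->|ij].
      by exists (j |: V); rewrite !inE -/V eqxx.
    have [|W WP iW] := cov i; first by rewrite inE iS.
    have [WV|WV] := eqVneq W V.
      by exists (j |: V); rewrite !inE -/V ?eqxx // -WV iW orbT.
    by exists W; rewrite // !inE -/V WV WP orbT.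
  - move=> W W' i /addE[->|[WP WV]] /addE[->|[WP' WV']] // iW iW'.
    + by case: (disj W' i).
    + by case: (disj W i).
    + exact: (uniq _ _ i).
have pbE : pblock (block_add j x P) x = j |: V.
  by apply: (pblockE pA); rewrite !inE -/V ?eqxx // xV orbT.
split => //.
- apply/ncpP; split => // W W' a b c d /addE[->|[WP WV]] /addE[->|[WP' WV']] //.
  + rewrite !inE => aV bW cV dW ab bc cd.
    have /andP[dS dj] := subE _ _ WP' dW.
    have aV' : a \in V.
      case/orP: aV => // /eqP aj.
      by have := ltn_trans (ltn_trans (ltn_trans ab bc) cd) dj; rewrite aj ltnn.
    have cV' : c \in V.
      by case/orP: cV => // /eqP cj; have := ltn_trans cd dj; rewrite cj ltnn.
    by move/eqP: WV'; case; apply/esym; exact: (nc V W' a b c d).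
  + rewrite !inE => aW bV cW dV ab bc cd.
    have /andP[aS _] := subE _ _ WP aW; have /andP[cS cj] := subE _ _ WP cW.
    have bV' : b \in V.
      by case/orP: bV => // /eqP bj; have := ltn_trans bc cj; rewrite bj ltnn.
    have := xmin _ aS; rewrite leq_eqVlt => /orP[/eqP/val_inj xa|xa].
      by move/eqP: WV; case; apply: (uniq _ _ a) => //; rewrite -xa.
    by move/eqP: WV; case; apply/esym; exact: (nc V W x a b c).
  + exact: nc.
- rewrite /block_del pbE; apply/finset.setP => W; rewrite !inE -/V.
  have -> : (j |: V) :\ j = V.
    apply/finset.setP => i; rewrite !inE; case: eqVneq => [->|//] /=.
    by rewrite (negbTE (jn _ VP)).
  have [->|WV] //= := eqVneq W V; have [WjV|] //= := eqVneq W (j |: V).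
  rewrite WjV; apply/esym/negbTE/negP => /jn; by rewrite !inE eqxx.
Qed.

Lemma block_delP P S x j :
  P \in ncp (upto S j) -> x \in S -> j \in S -> (x < j)%N ->
  j \in pblock P x ->
  [/\ block_del j x P \in ncp (below S j),
      pblock (block_del j x P) x = pblock P x :\ j &
      block_add j x (block_del j x P) = P].
Proof.
move=> /ncpP[pP nc] xS jS xj jV; have [ne sub cov uniq] := pP.
have subE V i : V \in P -> i \in V -> (i \in S) && (i <= j)%N.
  by move=> VQ iV; have := sub _ _ VQ iV; rewrite inE.
have [VP xV] : pblock P x \in P /\ x \in pblock P x.
  by apply: (pblock_ex pP); rewrite inE xS ltnW.
set V := pblock P x in VP xV jV *.
have xj' : x != j by apply: contraTneq xj => ->; rewrite ltnn.
have delE W : W \in block_del j x P -> W = V :\ j \/ W \in P /\ W != V.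
  by rewrite !inE -/V => /orP[/eqP|/andP[]]; [left|right].
have jn W : W \in P -> W != V -> j \notin W.
  by move=> WP; apply: contra => jW; apply/eqP; exact: (uniq _ _ j).
have lt W i : W \in P -> i \in W -> i != j -> (i \in S) && (i < j)%N.
  move=> WP /(subE _ _ WP)/andP[-> ij] ne_ij; rewrite ltn_neqAle ij andbT.
  by apply: contra ne_ij => /eqP/val_inj ->.
have disj W i : W \in P -> W != V -> i \in V :\ j -> i \in W -> False.
  move=> WP WV; rewrite !inE => /andP[_ iV] iW.
  by move/eqP: WV; apply; exact: (uniq _ _ i).
have pD : is_partition (block_del j x P) (below S j).
  split.
  - by move=> W /delE[->|[/ne//]]; exists x; rewrite !inE xV xj'.
  - move=> W i /delE[->|[WP WV] iW]; rewrite [_ \in below _ _]inE.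
      by rewrite !inE => /andP[ij iV]; exact: lt iV ij.
    by apply: (lt _ _ WP iW); apply: contraNneq (jn _ WP WV) => <-.
  - move=> i; rewrite inE => /andP[iS ij].
    have [|W WP iW] := cov i; first by rewrite inE iS ltnW.
    have [WV|WV] := eqVneq W V.
      exists (V :\ j); rewrite !inE -/V ?eqxx // -WV iW andbT.
      by apply: contraTneq ij => ->; rewrite ltnn.
    by exists W; rewrite // !inE -/V WV WP orbT.
  - move=> W W' i /delE[->|[WP WV]] /delE[->|[WP' WV']] // iW iW'.
    + by case: (disj W' i).
    + by case: (disj W i).
    + exact: (uniq _ _ i).
have pbE : pblock (block_del j x P) x = V :\ j.
  by apply: (pblockE pD); rewrite !inE -/V ?eqxx // xV xj'.
split => //.
- apply/ncpP; split => // W W' a b c d /delE[->|[WP WV]] /delE[->|[WP' WV']] //.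
  + rewrite !inE => /andP[_ aV] bW /andP[_ cV] dW ab bc cd.
    by move/eqP: WV'; case; apply/esym; exact: (nc V W' a b c d).
  + rewrite !inE => aW /andP[_ bV] cW /andP[_ dV] ab bc cd.
    by move/eqP: WV; case; exact: (nc W V a b c d).
  + exact: nc.
- rewrite /block_add pbE; apply/finset.setP => W; rewrite !inE -/V.
  rewrite finset.setD1K //.
  have [->|WV] //= := eqVneq W V; have [WVj|] //= := eqVneq W (V :\ j).
  apply/esym/negbTE/negP => WP; apply: (disj W x) => //; by rewrite ?WVj !inE xj' xV.
Qed.

End NoncrossingSets.

(** * The recursion of sums over non-crossing partitions *)

Section BlockSums.
Variables (K : comNzRingType) (r : nat -> K).

Definition ncp_sum N (S : {set 'I_N}) : K :=
  \sum_(P in ncp S) \prod_(V in P) r #|V|.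

(** The shift k accounts for the elements that the recursion has already removed
    from the block of x. *)
Definition first_weight N k (x : 'I_N) (P : {set {set 'I_N}}) : K :=
  r (#|pblock P x| + k) * \prod_(V in P :\ pblock P x) r #|V|.

Definition first_block_sum N k (x : 'I_N) (S : {set 'I_N}) : K :=
  \sum_(P in ncp S) first_weight k x P.

Section OneSet.
Context {N : nat}.
Implicit Types (S A B V W : {set 'I_N}) (P Q : {set {set 'I_N}}) (x j : 'I_N).

Lemma ncp_sum0 : ncp_sum (finset.set0 : {set 'I_N}) = 1.
Proof. by rewrite /ncp_sum ncp0 !big_set1 big_set0. Qed.

Lemma ncp_sum_first x S : x \in S -> ncp_sum S = first_block_sum 0 x S.
Proof.
move=> xS; apply: eq_bigr => P /ncpP[pP _].
by rewrite /first_weight addn0 -big_setD1 //; have [] := pblock_ex pP xS.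
Qed.

Lemma ex_last P S x : P \in ncp S -> x \in S ->
  exists2 j, j \in S & forall i, (i \in S) && is_last P x i = (i == j).
Proof.
move=> /ncpP[pP _] xS; have [VP xV] := pblock_ex pP xS.
have [ne sub _ _] := pP.
case: (arg_maxnP (fun i : 'I_N => val i) xV) => j jV jmax.
exists j; first exact: sub jV.
move=> i; apply/and3P/eqP => [[iS iV /forall_inP/(_ j jV) ji]|->].
  by apply: val_inj; apply/eqP; rewrite eqn_leq ji (jmax i iV : (i <= j)%N).
by split; [exact: sub jV|exact: jV|apply/forall_inP].
Qed.

(** The last element j is removed from the block of x, which the weight records by
    increasing the shift. For j = x, the block {x} is the whole partition and
    would become empty. *)
Lemma first_block_sum_upto k x j S : x \in S -> j \in S ->
  (forall i, i \in S -> (x <= i)%N) ->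
  \sum_(Q in ncp (upto S j) | j \in pblock Q x) first_weight k x Q =
  if j == x then r k.+1 else first_block_sum k.+1 x (below S j).
Proof.
move=> xS jS xmin; have [->|jx] := eqVneq j x.
  have -> : upto S x = [set x].
    apply/finset.setP => i; rewrite !inE; apply/andP/eqP => [[iS ix]|->//].
    by apply: val_inj; apply/eqP; rewrite eqn_leq ix xmin.
  have pb : pblock [set [set x]] x = [set x].
    have : [set [set x]] \in ncp [set x] by rewrite ncp1 finset.set11.
    by move=> /ncpP[/pblockE pE _]; apply: pE; rewrite finset.set11.
  rewrite big_mkcondr ncp1 big_set1 pb finset.set11 /first_weight pb finset.cards1.
  by rewrite finset.setDv big_set0 mulr1.
have xj : (x < j)%N.
  by rewrite ltn_neqAle xmin // andbT; apply: contra jx => /eqP/val_inj ->.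
rewrite (reindex_onto (block_add j x) (block_del j x)) => [|Q /andP[Qn jV]]; last first.
  by have [] := block_delP Qn xS jS xj jV.
apply: eq_big => Q.
  apply/andP/idP => [[/andP[Qn jV] /eqP <-]|Qn].
    by have [] := block_delP Qn xS jS xj jV.
  by have [-> -> ->] := block_addP Qn xS jS xj xmin; rewrite !inE !eqxx.
move=> /andP[/andP[Qa jV] /eqP Qe].
have Qn : Q \in ncp (below S j) by rewrite -Qe; have [] := block_delP Qa xS jS xj jV.
have [_ pbE _] := block_addP Qn xS jS xj xmin.
have [pQ _] := ncpP _ _ Qn; have [_ sub _ _] := pQ.
have [VP xV] : pblock Q x \in Q /\ x \in pblock Q x.
  by apply: (pblock_ex pQ); rewrite inE xS.
have jn V : V \in Q -> j \notin V.
  by move=> VQ; apply/negP => /(sub _ _ VQ); rewrite inE ltnn andbF.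
rewrite /first_weight pbE cardsU1 jn // addSnnS; congr (_ * _).
apply: eq_bigl => W; rewrite /block_add !inE.
have [->|WV] //= := eqVneq W (j |: pblock Q x).
apply/esym/negbTE; rewrite negb_and; apply/orP; right.
by apply/negP => /jn; rewrite !inE eqxx.
Qed.

(** The sum is split according to the last element j of the block of x = min S:
    the elements above j are then partitioned independently of the others. *)
Lemma first_block_sum_rec k x S : x \in S -> (forall i, i \in S -> (x <= i)%N) ->
  first_block_sum k x S =
  \sum_(j in S) (if j == x then r k.+1 else first_block_sum k.+1 x (below S j))
                * ncp_sum (above S j).
Proof.
move=> xS xmin.
transitivity (\sum_(j in S) \sum_(P in ncp S | is_last P x j) first_weight k x P).
  rewrite (exchange_big_dep (mem (ncp S))) /=; last by move=> j P _ /andP[].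
  apply: eq_bigr => P Pn; have [j jS jE] := ex_last Pn xS.
  by rewrite (big_pred1 j) // => i; rewrite /= Pn jE.
apply: eq_bigr => j jS; rewrite -first_block_sum_upto // big_distrlr /= pair_big /=.
rewrite (reindex_onto
  (fun Q : {set {set 'I_N}} * {set {set 'I_N}} => Q.1 :|: Q.2)
  (fun P => (P ::&: upto S j, P ::&: above S j))) /=; last first.
  by move=> P /andP[Pn Pl]; have [_ _ _ <-] := ncp_split Pn xS xmin Pl.
apply: eq_big => -[Q Q'] /=.
  apply/andP/andP => [[/andP[Pn Pl] /eqP[eQ eQ']]|[/andP[Qn jV] Qn']].
    have [Qn Qn' pbE _] := ncp_split Pn xS xmin Pl; rewrite eQ eQ' in Qn Qn' pbE.
    by rewrite Qn Qn' pbE; case/andP: Pl => ->.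
  by have [-> _ -> -> ->] := ncp_union xS jS xmin Qn Qn' jV.
move=> /andP[/andP[Pn Pl] /eqP[eQ eQ']].
have [Qn Qn' pbE _] := ncp_split Pn xS xmin Pl; rewrite eQ eQ' in Qn Qn' pbE.
rewrite /first_weight -pbE -mulrA; congr (_ * _).
have [pQ _] := ncpP _ _ Qn; have [_ sub _ _] := pQ.
have [pQ' _] := ncpP _ _ Qn'; have [ne' sub' _ _] := pQ'.
have disj V : V \in Q -> V \in Q' -> False.
  move=> VQ VQ'; have [i iV] := ne' _ VQ'.
  have := sub _ _ VQ iV; have := sub' _ _ VQ' iV.
  by rewrite !inE ltnNge => /andP[_ /negbTE ->]; rewrite andbF.
have [VQ xV] : pblock Q x \in Q /\ x \in pblock Q x.
  by apply: (pblock_ex pQ); rewrite inE xS xmin.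
rewrite -bigU /=; last first.
  rewrite -finset.setI_eq0; apply/eqP/finset.setP => V; rewrite !inE.
  by apply/negbTE/negP => /andP[/andP[_ /disj]].
apply: eq_bigl => V; rewrite !inE.
have [->|//] := eqVneq V (pblock Q x); apply/esym/negbTE/negP; exact: disj.
Qed.

Lemma card_below_sum S (f : nat -> K) :
  \sum_(j in S) f #|below S j| = \sum_(i < #|S|) f i.
Proof.
move: {2}#|S| (erefl #|S|) => n; elim: n S => [|n IH] S Sn.
  by rewrite Sn big_ord0 (cards0_eq Sn) big_set0.
have [x0 x0S] : exists x, x \in S by apply/finset.set0Pn; rewrite -card_gt0 Sn.
case: (arg_maxnP (fun i : 'I_N => val i) x0S) => m m_in max_m.
have mS : m \in S := m_in.
have mmax i : i \in S -> (i <= m)%N := max_m i.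
rewrite (big_setD1 m) //= Sn big_ord_recr addrC /=.
have Sm : #|S :\ m| = n by have := finset.cardsD1 m S; rewrite mS Sn => -[].
congr (_ + _); last first.
  congr f; rewrite -Sm; apply: eq_card => i; rewrite !inE andbC.
  have [->|im] := eqVneq i m; first by rewrite ltnn.
  case iS : (i \in S); rewrite ?andbF //= andbT ltn_neqAle mmax // andbT.
  by apply: contra im => /eqP/val_inj ->.
rewrite -Sm -IH //; apply: eq_bigr => j; rewrite inE => /andP[jm jS].
congr f; apply: eq_card => i; rewrite !inE; case: eqVneq => [->|//].
by rewrite mS ltnNge mmax.
Qed.

Lemma card_below_above S j : j \in S -> #|above S j| = (#|S| - #|below S j|.+1)%N.
Proof.
move=> jS; rewrite -(cardsID (upto S j) S).
have -> : #|S :&: upto S j| = #|below S j|.+1.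
  rewrite (cardsD1 j) !inE jS leqnn add1n; congr _.+1; apply: eq_card => i.
  rewrite !inE ltn_neqAle -(inj_eq val_inj) /=.
  by case: (i \in S); rewrite ?andbF //= !andbT.
rewrite addKn; apply: eq_card => i; rewrite !inE ltnNge.
by rewrite andbC; case: (i \in S); rewrite ?andbF ?andbT.
Qed.

End OneSet.

Definition ncp_moment n : K := ncp_sum [set: 'I_n].
(** The value at n = 0 stands for a block whose remaining elements have all been
    removed; with it, first_moment_rec has no exceptional term. *)
Definition first_moment k n : K :=
  if n is m.+1 then first_block_sum k ord0 [set: 'I_m.+1] else r k.

Definition only_card n := forall N (S : {set 'I_N}), #|S| = n ->
  ncp_sum S = ncp_moment n /\
  forall k x, x \in S -> (forall i, i \in S -> (x <= i)%N) ->
    first_block_sum k x S = first_moment k n.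

Let first_block_sum_card_rec n k N (S : {set 'I_N}) x :
  (forall m, (m < n.+1)%N -> only_card m) ->
  #|S| = n.+1 -> x \in S -> (forall i, i \in S -> (x <= i)%N) ->
  first_block_sum k x S =
  \sum_(i < n.+1) first_moment k.+1 i * ncp_moment (n - i).
Proof.
move=> IH Sn xS xmin; rewrite first_block_sum_rec // -Sn.
rewrite -(card_below_sum S (fun i => first_moment k.+1 i * ncp_moment (n - i))).
apply: eq_bigr => j jS; congr (_ * _); last first.
  have := card_below_above jS; rewrite Sn subSS => ja.
  have lt_above : (n - #|below S j| < n.+1)%N by rewrite ltnS leq_subr.
  by have [-> _] := IH _ lt_above _ _ ja.
have [->|jx] := eqVneq j x.
  have -> : below S x = finset.set0; last by rewrite finset.cards0.
  apply/finset.setP => i; rewrite !inE; apply/negbTE/negP => /andP[iS].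
  by rewrite ltnNge xmin.
have lt_below : (#|below S j| < n.+1)%N.
  rewrite -Sn; apply: proper_card; apply/properP; split.
    by apply/fintype.subsetP => i; rewrite inE => /andP[].
  by exists j; rewrite // inE ltnn andbF.
have [_ ->] := IH _ lt_below _ (below S j) erefl => //.
  rewrite inE xS ltn_neqAle xmin // andbT.
  by apply: contra jx => /eqP/val_inj ->.
by move=> i; rewrite inE => /andP[iS _]; exact: xmin.
Qed.

(** Both sides obey the same recursion, in which only cardinals occur. *)
Lemma ncp_sum_card n : only_card n.
Proof.
elim/ltn_ind: n => -[|n] IH N S Sn.
  rewrite (cards0_eq Sn) /ncp_moment ncp_sum0; split; last by move=> k x; rewrite inE.
  by rewrite (_ : [set: 'I_0] = finset.set0) ?ncp_sum0 //; apply/finset.setP => -[].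
have recS k x : x \in S -> (forall i, i \in S -> (x <= i)%N) ->
    first_block_sum k x S = first_moment k n.+1.
  move=> xS xmin; rewrite (first_block_sum_card_rec k IH Sn) // /first_moment.
  by rewrite (first_block_sum_card_rec (n := n)) ?inE // cardsT card_ord.
split=> //.
have [x0 x0S] : exists x, x \in S by apply/finset.set0Pn; rewrite -card_gt0 Sn.
case: (arg_minnP (fun i : 'I_N => val i) x0S) => x x_in xmin.
have xS : x \in S := x_in.
by rewrite (ncp_sum_first xS) recS // /ncp_moment (@ncp_sum_first _ ord0) ?inE.
Qed.

Lemma first_moment_rec k n :
  first_moment k n.+1 = \sum_(i < n.+1) first_moment k.+1 i * ncp_moment (n - i).
Proof.
apply: first_block_sum_card_rec; rewrite ?inE ?cardsT ?card_ord //.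
by move=> m _; exact: ncp_sum_card.
Qed.

Lemma ncp_moment0 : ncp_moment 0 = 1.
Proof.
rewrite /ncp_moment (_ : [set: 'I_0] = finset.set0) ?ncp_sum0 //.
by apply/finset.setP => -[].
Qed.

Lemma ncp_momentS n : ncp_moment n.+1 = first_moment 0 n.+1.
Proof. by rewrite /ncp_moment (@ncp_sum_first _ ord0) ?inE. Qed.

End BlockSums.

(** * The infinitesimal moment-cumulant formula as a power series identity *)

Section FirstOrder.
Variable K : comNzRingType.

Lemma coef0_prod I (s : seq I) (P : pred I) (F : I -> {poly K}) :
  (\prod_(i <- s | P i) F i)`_0 = \prod_(i <- s | P i) (F i)`_0.
Proof.
by elim/big_rec2: _ => [|i x y _ <-]; rewrite ?coef1 // coefM big_ord1.
Qed.

Lemma coef1M (p q : {poly K}) : (p * q)`_1 = p`_0 * q`_1 + p`_1 * q`_0.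
Proof. by rewrite coefM big_ord_recl big_ord1. Qed.

Lemma coef1_prod (I : finType) (A : {set I}) (F : I -> {poly K}) :
  (\prod_(i in A) F i)`_1 =
  \sum_(i in A) (F i)`_1 * \prod_(j in A | j != i) (F j)`_0.
Proof.
move: {2}#|A| (erefl #|A|) => n; elim: n A => [|n IH] A An.
  by rewrite (cards0_eq An) !big_set0 coef1.
have [i iA] : exists i, i \in A by apply/finset.set0Pn; rewrite -card_gt0 An.
have Ai : #|A :\ i| = n by have := finset.cardsD1 i A; rewrite iA An => -[].
rewrite (big_setD1 i) //= coef1M (IH _ Ai) [RHS](big_setD1 i) //= addrC mulr_sumr.
congr (_ + _); last first.
  by rewrite coef0_prod; congr (_ * _); apply: eq_bigl => j; rewrite !inE andbC.
apply: eq_bigr => j; rewrite !inE => /andP[ji jA].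
rewrite [\prod_(_ in A | _) _](bigD1 i) /=; last by rewrite iA eq_sym.
rewrite mulrCA; congr (_ * (_ * _)); apply: eq_bigl => l; rewrite !inE.
by case: (l \in A); case: (l == j); case: (l == i).
Qed.

End FirstOrder.

Section InfinitesimalMoments.
Context {R : realType}.
Variables m m' : nat -> R.
Hypotheses (m0 : m 0 = 1) (m'0 : m' 0 = 0).

Let r := free_cumulant m.
Let u := inf_free_cumulant m m'.

(* First-order perturbation of the cumulants r in the direction u. *)
Let rho k : {poly R} := (r k)%:P + u k *: 'X.

Let rho0 k : (rho k)`_0 = r k.
Proof. by rewrite coefD coefC coefZ coefX mulr0 addr0. Qed.

Let rho1 k : (rho k)`_1 = u k.
Proof. by rewrite coefD coefC coefZ coefX mulr1 add0r. Qed.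

Let ncp_moment_coef0 n : (ncp_moment rho n)`_0 = m n.
Proof.
case: n => [|n]; first by rewrite ncp_moment0 coef1 m0.
rewrite (moment_free_cumulant m (ltn0Sn n)) coef_sum; apply: eq_bigr => P _.
by rewrite coef0_prod; apply: eq_bigr => V _; rewrite rho0.
Qed.

Let ncp_moment_coef1 n : (ncp_moment rho n)`_1 = m' n.
Proof.
case: n => [|n]; first by rewrite ncp_moment0 coef1 m'0.
rewrite (moment_inf_free_cumulant m m' (ltn0Sn n)) coef_sum; apply: eq_bigr => P _.
rewrite coef1_prod; apply: eq_bigr => V _; rewrite rho1; congr (_ * _).
by apply: eq_bigr => W _; rewrite rho0.
Qed.

Let b k : fps R := fun n => (first_moment rho k n)`_0.
Let b' k : fps R := fun n => (first_moment rho k n)`_1.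
Let M : fps R := m.
Let M' : fps R := m'.

Let b_rec k : b k = fpsC (r k) + fpsX R * (b k.+1 * M).
Proof.
apply: fpsP => -[|n]; rewrite fpsED fpsEXM /= ?addr0 ?add0r.
  by rewrite /b /= rho0.
rewrite /b first_moment_rec coef_sum fpsEM; apply: eq_bigr => i _.
by rewrite coefM big_ord1 ncp_moment_coef0.
Qed.

Let b'_rec k : b' k = fpsC (u k) + fpsX R * (b' k.+1 * M + b k.+1 * M').
Proof.
apply: fpsP => -[|n]; rewrite fpsED fpsEXM /= ?addr0 ?add0r.
  by rewrite /b' /= rho1.
rewrite /b' first_moment_rec coef_sum fpsED !fpsEM -big_split; apply: eq_bigr => i _.
by rewrite coef1M ncp_moment_coef0 ncp_moment_coef1 addrC.
Qed.

(** With g = t M(t), the moment-cumulant formula reads M = 1 + r(g). Let c be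
    dr/ds evaluated at s = g. Varying the cumulants gives M' = u(g) + c t M', and
    differentiating gives D g = g + t D M = g + c t D g; the factor 1 - c t is
    eliminated between the two. The proof performs this elimination on the
    recursion in the shift k, before it is unrolled, so that c never has to be
    written down. *)
Lemma inf_moment_cumulant_fps :
  M' * (fpsX R * M) = fps_comp u (fpsX R * M) * fpsD (fpsX R * M).
Proof.
set g := fpsX R * M.
have g0 : g 0%N = 0 by rewrite /g fpsEXM.
pose F k := b' k * fpsD g - fpsX R * M' * fpsD (b k).
have F0 : F 0%N = M' * g.
  have Db0 : fpsD (b 0) = fpsD M.
    apply: fpsP => -[|n]; first by rewrite /fpsD !mul0r.
    by rewrite /fpsD /b -ncp_momentS ncp_moment_coef0.
  have b'0 : b' 0 = M'.
    apply: fpsP => -[|n]; last by rewrite /b' -ncp_momentS ncp_moment_coef1.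
    by rewrite /b' /= rho1 /u /inf_free_cumulant /strong_rec /M' m'0.
  by rewrite /F b'0 Db0 /g fpsDM fpsDX; ring.
have F_rec k : F k = fpsC (u k) * fpsD g + g * F k.+1.
  rewrite /F b'_rec (b_rec k) fpsDD fpsDC add0r.
  have -> : fpsX R * (b k.+1 * M) = b k.+1 * g by rewrite /g mulrCA.
  by rewrite fpsDM /g; ring.
apply/eqP; rewrite -F0 -subr_eq0; apply/eqP.
pose G k := F k - fps_comp (fun n => u (k + n)%N) g * fpsD g.
rewrite -/(G 0%N); apply: (fps_rec_eq0 (s := succn) g0) => k.
rewrite /G F_rec fps_comp_rec // addn0.
have -> : fps_shift (fun n => u (k + n)%N) = (fun n => u (k.+1 + n)%N).
  by apply: fpsP => n; rewrite /fps_shift addnS.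
by ring.
Qed.

End InfinitesimalMoments.

(** * Power sums and the finite-free convolution *)

Section PowerSums.
Context {K : fieldType}.
Implicit Types (s : seq K) (n : nat).

Definition rev_prod s : fps K := \prod_(a <- s) (1 - fpsC a * fpsX K).
Definition power_sums s : fps K := fun n => \sum_(a <- s) a ^+ n.

Lemma rev_prod_cons a s :
  rev_prod (a :: s) = rev_prod s - fpsX K * (fpsC a * rev_prod s).
Proof. by rewrite /rev_prod big_cons; ring. Qed.

Lemma power_sums0 s : power_sums s 0%N = (size s)%:R.
Proof.
rewrite /power_sums; under eq_bigr do rewrite expr0.
by rewrite big_const_seq count_predT iter_addr_0.
Qed.

Lemma rev_prod0 s : rev_prod s 0%N = 1.
Proof.
elim: s => [|a s IH]; first by rewrite /rev_prod big_nil.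
by rewrite rev_prod_cons fpsED fpsEN fpsEXM IH subr0.
Qed.

Lemma coef_rev_prod s n : rev_prod s n =
  if (n <= size s)%N then (\prod_(a <- s) ('X - a%:P))`_(size s - n) else 0.
Proof.
elim: s n => [|a s IH] n.
  by rewrite /rev_prod !big_nil fpsE1; case: n => [|n] //=; rewrite coef1.
rewrite rev_prod_cons big_cons mulrBl coefB coefXM coefCM fpsED fpsEN fpsEXM /=.
have s0 : (\prod_(a <- s) ('X - a%:P))`_(size s).+1 = 0.
  by rewrite nth_default // size_prod_XsubC.
case: n => [|n]; first by rewrite IH leq0n !subn0 /= s0 mulr0.
rewrite fpsECM !IH subSS ltnS; case: (ltngtP n (size s)) => [ns|ns|->].
- by rewrite subn_eq0 leqNgt ns /= subnS.
- by rewrite mulr0 subr0.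
- by rewrite subnn eqxx.
Qed.

(** Newton's identities: each factor 1 - a t contributes - a t / (1 - a t). *)
Lemma fpsD_rev_prod s :
  fpsD (rev_prod s) = rev_prod s * (fpsC (size s)%:R - power_sums s).
Proof.
elim: s => [|a s IH].
  rewrite /rev_prod big_nil -fpsC1 fpsDC fpsC1 mul1r; apply: fpsP => n.
  by rewrite fpsE0 fpsED fpsEN /power_sums big_nil subr0; case: n.
pose geo : fps K := fun n => a ^+ n.
have geoE : (1 - fpsC a * fpsX K) * geo = 1.
  apply: fpsP => n; rewrite mulrBl mul1r -mulrA fpsED fpsEN fpsECM fpsEXM fpsE1.
  by case: n => [|n]; rewrite /geo ?mulr0 ?subr0 // exprS subrr.
have PE : power_sums (a :: s) = geo + power_sums s.
  by apply: fpsP => n; rewrite fpsED /power_sums big_cons.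
have CE : fpsC (size (a :: s))%:R = 1 + fpsC (size s)%:R :> fps K.
  by apply: fpsP => -[|n]; rewrite fpsED /= ?addr0 // nat1r.
have AE : rev_prod (a :: s) = (1 - fpsC a * fpsX K) * rev_prod s.
  by rewrite /rev_prod big_cons.
have -> : fpsD (rev_prod (a :: s)) = (1 - fpsC a * fpsX K - 1) * rev_prod s +
    (1 - fpsC a * fpsX K) * fpsD (rev_prod s).
  rewrite AE fpsDM; congr (_ * _ + _); rewrite fpsDD -fpsC1 fpsDC add0r.
  have -> : - (fpsC a * fpsX K) = fpsC (- a) * fpsX K.
    by apply: fpsP => n; rewrite fpsEN !fpsECM mulNr.
  by rewrite fpsDM fpsDC mul0r add0r fpsDX fpsC1 addrAC subrr add0r.
rewrite IH PE CE AE -[X in _ - X]geoE.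
by ring.
Qed.

End PowerSums.

Section FiniteFreeSeries.
Context {R : realType}.
Implicit Types (d k n : nat) (p q : {poly R}) (P : fps R) (s t : seq R).

(** With P the power sums of the roots of a monic polynomial p of degree d, this
    is the expansion of p^(k)(x) / ((d)_k p(x)) in t = 1/x, where
    (d)_k = d (d - 1) ... (d - k + 1). The recursion comes from differentiating
    this quotient; it has the advantage that p enters through P only. *)
Fixpoint deriv_quotient d P k : fps R :=
  if k is k'.+1 then
    let H := deriv_quotient d P k' in
    fpsX R * (fpsC (d%:R - k'%:R)^-1 * (P * H - fpsD H))
  else 1.

Lemma deriv_quotient_lt d P k n : (n < k)%N -> deriv_quotient d P k n = 0.
Proof.
elim: k n => // k IH [|n] nk; rewrite /= fpsEXM // fpsECM fpsED fpsEN fpsEM.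
rewrite /fpsD IH // big1 => [|i _]; first by rewrite mulr0 subr0 mulr0.
by rewrite IH ?mulr0 // (leq_ltn_trans (leq_subr _ _)).
Qed.

(** On multiplying by p, the recursion becomes the differentiation of p^(k), whose
    coefficients are explicit. *)
Lemma rev_prod_deriv_quotient s k n : (k <= size s)%N ->
  (rev_prod s * deriv_quotient (size s) (power_sums s) k) n =
  if (k <= n)%N then
    rev_prod s (n - k)%N * 'C(size s - (n - k), k)%:R / 'C(size s, k)%:R
  else 0.
Proof.
set d := size s; set A := rev_prod s.
elim: k n => [|k IH] n kd; first by rewrite mulr1 subn0 !bin0 mulr1 divr1.
have dk : d%:R - k%:R != 0 :> R.
  by rewrite -natrB ?(ltnW kd) // pnatr_eq0 subn_eq0 -ltnNge.
rewrite [deriv_quotient _ _ _]/=; set H := deriv_quotient _ _ k in IH *.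
have -> : A * (fpsX R * (fpsC (d%:R - k%:R)^-1 * (power_sums s * H - fpsD H))) =
    fpsX R * (fpsC (d%:R - k%:R)^-1 * (fpsC d%:R * (A * H) - fpsD (A * H))).
  by rewrite fpsDM fpsD_rev_prod -/A -/d; ring.
rewrite fpsEXM; case: n => // n.
rewrite fpsECM fpsED fpsEN fpsECM /fpsD !(IH _ (ltnW kd)) ltnS subSS.
case: ifP => kn; last first.
  by rewrite !mulr0 subr0 mulr0.
have C0 : 'C(d, k)%:R != 0 :> R by rewrite pnatr_eq0 -lt0n bin_gt0 (ltnW kd).
have k0 : k.+1%:R != 0 :> R by rewrite pnatr_eq0.
have binS (m : nat) : 'C(m, k.+1)%:R = (m%:R - k%:R) * 'C(m, k)%:R / k.+1%:R :> R.
  apply: (mulIf k0); rewrite divfK // mulrC -natrM mul_bin_left natrM.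
  by have [km|mk] := leqP k m; [rewrite natrB|rewrite bin_small // !mulr0].
rewrite !binS.
have [nk|nk] := leqP (n - k) d; last first.
  by rewrite /A coef_rev_prod -/d leqNgt nk /= !(mul0r, mulr0) subr0 mulr0.
have -> : (d - (n - k))%N%:R - k%:R = d%:R - n%:R :> R.
  by rewrite !natrB //; ring.
by field; rewrite ?nat1r dk k0 C0.
Qed.

(** The combination of the quotients p^(k) / ((d)_k p) with coefficients f k; the
    k-th quotient starts in degree k, so the sum stops at n. *)
Definition mix_quotients d P (f : fps R) : fps R :=
  fun n => \sum_(k < n.+1) f k * deriv_quotient d P k n.

(** The finite-free convolution with q is the differential operator
    sum_k (-1)^k E_k(q) (d/dx)^k / (d)_k, with E_k the elementary symmetric functions
    of the roots. Divided by p, it becomes a series in the quotients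
    p^(k) / ((d)_k p), which behave like powers of p' / (d p). *)
Lemma rev_prod_ffconv d p q s t u :
  p = \prod_(a <- s) ('X - a%:P) -> size s = d ->
  q = \prod_(a <- t) ('X - a%:P) -> size t = d ->
  ffconv d p q = \prod_(a <- u) ('X - a%:P) -> size u = d ->
  rev_prod u = rev_prod s * mix_quotients d (power_sums s) (rev_prod t).
Proof.
move=> ps sd qt td ru ud; apply: fpsP => n.
have -> : (rev_prod s * mix_quotients d (power_sums s) (rev_prod t)) n =
    \sum_(k < n.+1) rev_prod t k *
       (rev_prod s * deriv_quotient d (power_sums s) k) n.
  rewrite fpsEM; under [RHS]eq_bigr do rewrite fpsEM mulr_sumr.
  rewrite exchange_big /=; apply: eq_bigr => i _.
  rewrite /mix_quotients (big_ord_widen n.+1 (fun k => rev_prod t k *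
    deriv_quotient d (power_sums s) k (n - i)%N)) ?ltnS ?leq_subr //.
  rewrite big_mkcond mulr_sumr; apply: eq_bigr => k _; case: ltnP => kn.
    by rewrite mulrCA.
  by rewrite deriv_quotient_lt // !mulr0.
have ps_coef j : (j <= d)%N -> rev_prod s j = p`_(d - j).
  by move=> jd; rewrite coef_rev_prod sd jd ps.
have qt_coef j : (j <= d)%N -> rev_prod t j = q`_(d - j).
  by move=> jd; rewrite coef_rev_prod td jd qt.
rewrite coef_rev_prod ud -ru; case: leqP => nd.
  rewrite coef_ffconv //; apply: eq_bigr => -[k /= kn] _; rewrite ltnS in kn.
  have kd := leq_trans kn nd.
  rewrite qt_coef // -sd rev_prod_deriv_quotient ?sd // kn ps_coef; first by ring.
  exact: leq_trans (leq_subr _ _) nd.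
rewrite big1 // => -[k /= kn] _; rewrite ltnS in kn.
have [kd|kd] := leqP k d; last by rewrite coef_rev_prod td leqNgt kd mul0r.
rewrite -sd rev_prod_deriv_quotient ?sd // kn.
have [nkd|nkd] := leqP (n - k) d; last first.
  by rewrite [rev_prod s _]coef_rev_prod sd leqNgt nkd /= !mul0r mulr0.
by rewrite bin_small ?mulr0 ?mul0r ?mulr0 // ltn_subLR // subnK.
Qed.

Lemma mix_quotients0 d P f : f 0%N = 1 -> mix_quotients d P f 0%N = 1.
Proof. by move=> f0; rewrite /mix_quotients big_ord1 f0 mul1r. Qed.

(** Taking logarithmic derivatives turns the product of rev_prod_ffconv into a
    difference of power sums. *)
Lemma power_sums_ffconv d p q s t u :
  p = \prod_(a <- s) ('X - a%:P) -> size s = d ->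
  q = \prod_(a <- t) ('X - a%:P) -> size t = d ->
  ffconv d p q = \prod_(a <- u) ('X - a%:P) -> size u = d ->
  let B := mix_quotients d (power_sums s) (rev_prod t) in
  B * (power_sums u - power_sums s) = - fpsD B.
Proof.
move=> ps sd qt td ru ud B.
have AE : rev_prod u = rev_prod s * B by exact: rev_prod_ffconv ru ud.
have := fpsD_rev_prod u; rewrite AE fpsDM fpsD_rev_prod sd ud => DE.
apply: (fps_mulI (rev_prod0 s)); apply/eqP; rewrite -subr_eq0; apply/eqP.
move/eqP: DE; rewrite -subr_eq0 => /eqP <-.
by ring.
Qed.

End FiniteFreeSeries.

(** * Limits of power series *)

Local Open Scope classical_set_scope.
Local Open Scope ring_scope.

Section Limits.
Context {R : realType}.
Implicit Types (F G : nat -> fps R) (L M : fps R) (n k d : nat).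

Definition fps_cvg F L := forall n, (fun d => F d n) @ \oo --> L n.

Lemma cvg_eventually (f g : nat -> R) (l : R) k :
  (forall d, (k < d)%N -> f d = g d) -> g @ \oo --> l -> f @ \oo --> l.
Proof.
move=> fg; apply: cvg_trans; apply: near_eq_cvg; near=> d.
by apply/esym/fg; near: d; exact: nbhs_infty_gt.
Unshelve. all: by end_near. Qed.

Lemma fps_cvg_eventually F G L k : (forall d, (k < d)%N -> F d = G d) ->
  fps_cvg G L -> fps_cvg F L.
Proof.
by move=> FG GL n; apply: (cvg_eventually (k := k)) (GL n) => d kd; rewrite FG.
Qed.

Lemma cvg_sum_ord n (f : nat -> nat -> R) (l : nat -> R) :
  (forall i, (i < n)%N -> (fun d => f d i) @ \oo --> l i) ->
  (fun d => \sum_(i < n) f d i) @ \oo --> \sum_(i < n) l i.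
Proof.
by move=> fl; apply: (cvg_big add_continuous) => i _; exact: fl.
Qed.

Lemma fps_cvg_cst L : fps_cvg (fun=> L) L.
Proof. by move=> n; exact: cvg_cst. Qed.

Lemma fps_cvgC (c : nat -> R) (l : R) : c @ \oo --> l ->
  fps_cvg (fun d => fpsC (c d)) (fpsC l).
Proof. by move=> cl [|n] //; exact: cvg_cst. Qed.

Lemma fps_cvgN F L : fps_cvg F L -> fps_cvg (fun d => - F d) (- L).
Proof. by move=> FL n; exact: cvgN (FL n). Qed.

Lemma fps_cvgB F G L M : fps_cvg F L -> fps_cvg G M ->
  fps_cvg (fun d => F d - G d) (L - M).
Proof. by move=> FL GM n; exact: cvgB (FL n) (GM n). Qed.

Lemma fps_cvgM F G L M : fps_cvg F L -> fps_cvg G M ->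
  fps_cvg (fun d => F d * G d) (L * M).
Proof.
move=> FL GM n; apply: (cvg_sum_ord (f := fun d i => F d i * G d (n - i)%N)
  (l := fun i => L i * M (n - i)%N)) => i _.
exact: cvgM (FL _) (GM _).
Qed.

Lemma fps_cvgD F L : fps_cvg F L -> fps_cvg (fun d => fpsD (F d)) (fpsD L).
Proof. by move=> FL n; apply: cvgM (FL n); exact: cvg_cst. Qed.

Lemma fps_cvg_unique F L M : fps_cvg F L -> fps_cvg F M -> L = M.
Proof.
by move=> FL FM; apply: fpsP => n; exact: (cvg_unique _ (FL n) (FM n)).
Qed.

Lemma inv_subn_cvg0 k : (fun d : nat => (d%:R - k%:R : R)^-1) @ \oo --> (0 : R).
Proof.
rewrite -(cvg_shiftn k.+1); apply: cvg_trans cvg_harmonic; apply: near_eq_cvg.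
apply: nearW => d; rewrite /harmonic /= addnS -addSn natrD.
by rewrite addrK.
Qed.

(** The derivative in the recursion of deriv_quotient comes with a factor
    1 / (d - k), while the power sums are of order d: only the product with the
    first quotient survives in the limit. *)
Lemma deriv_quotient_cvg F M k :
  fps_cvg (fun d => fpsC (d%:R)^-1 * F d) M ->
  fps_cvg (fun d => deriv_quotient d (F d) k) ((fpsX R * M) ^+ k).
Proof.
move=> FM; elim: k => [|k IH]; first exact: fps_cvg_cst.
pose c (d : nat) := (d%:R - k%:R : R)^-1.
have c0 := inv_subn_cvg0 k.
have c1 : (fun d : nat => 1 + k%:R * c d) @ \oo --> (1 : R).
  rewrite -[X in _ --> X]addr0 -[X in _ --> _ + X](mulr0 k%:R).
  by apply: cvgD; [exact: cvg_cst|apply: cvgM c0; exact: cvg_cst].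
pose H d := deriv_quotient d (F d) k.
apply: (fps_cvg_eventually (k := k) (G := fun d => fpsX R *
  (fpsC (1 + k%:R * c d) * (fpsC (d%:R)^-1 * F d) * H d - fpsC (c d) * fpsD (H d)))).
  move=> d kd; rewrite [LHS]/= -/(H d) -/(c d); congr (_ * _); rewrite mulrBr.
  congr (_ - _); rewrite !mulrA -fpsCM; congr (fpsC _ * _ * _).
  rewrite /c; field; rewrite pnatr_eq0 -natrB 1?ltnW // pnatr_eq0 subn_eq0 -ltnNge kd.
  by rewrite -lt0n (leq_ltn_trans _ kd).
have -> : (fpsX R * M) ^+ k.+1 = fpsX R * (fpsC 1 * M * (fpsX R * M) ^+ k -
    fpsC 0 * fpsD ((fpsX R * M) ^+ k)).
  by rewrite fpsC1 fpsC0 exprS; ring.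
apply: fps_cvgM; first exact: fps_cvg_cst.
apply: fps_cvgB; last by apply: fps_cvgM; [exact: fps_cvgC|exact: fps_cvgD].
by apply: fps_cvgM => //; apply: fps_cvgM => //; exact: fps_cvgC.
Qed.

Lemma mix_quotients_cvg F G M L :
  fps_cvg (fun d => fpsC (d%:R)^-1 * F d) M -> fps_cvg G L ->
  fps_cvg (fun d => mix_quotients d (F d) (G d)) (fps_comp L (fpsX R * M)).
Proof.
move=> FM GL n; apply: (cvg_sum_ord (f := fun d k => G d k * deriv_quotient d (F d) k n)
  (l := fun k => L k * ((fpsX R * M) ^+ k) n)) => k _.
by apply: cvgM; [exact: GL|exact: deriv_quotient_cvg].
Qed.

(** Newton's identities determine the elementary symmetric functions from the
    power sums of positive order, so convergence passes from the latter to the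
    former whatever the number of roots; subtracting this number discards the
    power sum of order 0. *)
Lemma rev_prod_cvg (s : nat -> seq R) (U : fps R) :
  fps_cvg (fun d => power_sums (s d) - fpsC (size (s d))%:R) U ->
  exists a : fps R, [/\ a 0%N = 1, fps_cvg (fun d => rev_prod (s d)) a &
    fpsD a = - (a * U)].
Proof.
set V := fun d => _ => VU.
have DA d : fpsD (rev_prod (s d)) = - (rev_prod (s d) * V d).
  by rewrite fpsD_rev_prod /V; ring.
have V0 d : V d 0%N = 0.
  by rewrite /V fpsED fpsEN power_sums0 subrr.
have AE d n : rev_prod (s d) n.+1 =
    - (n.+1%:R^-1) * \sum_(i < n.+1) rev_prod (s d) i * V d (n.+1 - i)%N.
  have n0 : n.+1%:R != 0 :> R by rewrite pnatr_eq0.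
  apply: (mulfI n0); rewrite mulrA mulrN divff // mulN1r.
  have := congr1 (fun f : fps R => f n.+1) (DA d).
  by rewrite /= fpsEN fpsEM big_ord_recr /= subnn V0 mulr0 addr0 => <-.
have cA n : cvg ((fun d => rev_prod (s d) n) @ \oo).
  elim/ltn_ind: n => -[|n] IH.
    by under eq_fun do rewrite rev_prod0; exact: is_cvg_cst.
  apply/cvg_ex; exists (- (n.+1%:R^-1) *
    \sum_(i < n.+1) lim ((fun d => rev_prod (s d) i) @ \oo) * U (n.+1 - i)%N).
  under eq_fun do rewrite AE.
  apply: cvgM; first exact: cvg_cst.
  apply: (cvg_sum_ord (f := fun d i => rev_prod (s d) i * V d (n.+1 - i)%N)
    (l := fun i => lim ((fun d => rev_prod (s d) i) @ \oo) * U (n.+1 - i)%N)) => i ni.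
  by apply: cvgM (VU _); exact: IH.
pose a : fps R := fun n => lim ((fun d => rev_prod (s d) n) @ \oo).
have Aa : fps_cvg (fun d => rev_prod (s d)) a by exact: cA.
exists a; split => //.
  by rewrite /a; under eq_fun do rewrite rev_prod0; exact: lim_cst.
apply: (fps_cvg_unique (fps_cvgD Aa)).
under eq_fun do rewrite DA.
exact: fps_cvgN (fps_cvgM Aa VU).
Qed.

(** Convergence of power series passes to quotients by series with constant
    term 1, as the coefficients of a quotient are polynomials in the others. *)
Lemma fps_cvg_quotient F G X L M Y :
  (forall d, (0 < d)%N -> F d 0%N = 1 /\ F d * X d = G d) ->
  fps_cvg F L -> fps_cvg G M -> L 0%N = 1 -> L * Y = M -> fps_cvg X Y.
Proof.
move=> FX FL GM L0 LY; elim/ltn_ind => n IH.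
have divE (A B C : fps R) : A 0%N = 1 -> A * B = C ->
    B n = C n - \sum_(i < n) A i.+1 * B (n - i.+1)%N.
  by move=> A0 <-; rewrite fpsEM big_ord_recl A0 mul1r subn0 addrK.
apply: (cvg_eventually (k := 0) (g := fun d => G d n -
    \sum_(i < n) F d i.+1 * X d (n - i.+1)%N)) => [d d0|].
  by have [F0 FXd] := FX d d0; exact: divE F0 FXd.
rewrite (divE _ _ _ L0 LY); apply: cvgB; first exact: GM.
apply: (cvg_sum_ord (f := fun d i => F d i.+1 * X d (n - i.+1)%N)
  (l := fun i => L i.+1 * Y (n - i.+1)%N)) => i ni.
by apply: cvgM (FL _) _; apply: IH; rewrite ltn_subrL (leq_ltn_trans _ ni).
Qed.

End Limits.

(** * Moments of the limit distributions *)

Section Moments.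
Context {R : realType}.
Implicit Types mu nu gamma : probability (measurableTypeR R) R.

Lemma moment0 mu : moment mu 0 = 1.
Proof.
rewrite /moment; under eq_Rintegral do rewrite expr0.
by rewrite Rintegral_cst // mul1r; exact: (congr1 fine (probability_setT mu)).
Qed.

Lemma moment_dirac0 nu n :
  (forall A : set (measurableTypeR R), measurable A -> nu A = \d_(0 : R) A) ->
  (0 < n)%N -> moment nu n = 0.
Proof.
move=> nuE n0; rewrite /moment /Rintegral.
have -> : (\int[nu]_x ((x : R) ^+ n)%:E =
    \int[\d_(0%R : measurableTypeR R)]_x ((x : R) ^+ n)%:E)%E.
  by apply: eq_measure_integral => A mA _; exact: nuE.
rewrite integral_dirac //.
  by rewrite diracT mul1e /= expr0n gtn_eqF.
by apply/measurable_realfun.measurable_EFinP; exact: measurable_realfun.exprn_measurable.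
Qed.

Lemma prod_blocks0 n (P : {set {set 'I_n}}) : (0 < n)%N -> P \in NC n ->
  prod_blocks (fun=> 0 : R) P = 0.
Proof.
case: n P => // n P _ /ncpP[[_ _ cov _] _].
have [V VP _] := cov ord0 (finset.in_setT _).
by rewrite /prod_blocks (big_setD1 V) //= mul0r.
Qed.

Lemma moment_eq_of_free_cumulant (m1 m2 : nat -> R) :
  (forall n, (0 < n)%N -> free_cumulant m1 n = free_cumulant m2 n) ->
  forall n, (0 < n)%N -> m1 n = m2 n.
Proof.
move=> rE n n0; rewrite (moment_free_cumulant m1 n0) (moment_free_cumulant m2 n0).
apply: eq_bigr => P /ncpP[[ne _ _ _] _]; apply: eq_bigr => V VP; apply: rE.
by rewrite card_gt0; apply/finset.set0Pn; exact: ne.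
Qed.

Lemma free_conv_dirac0_moment mu nu gamma :
  (forall n, (0 < n)%N -> moment nu n = 0) -> is_free_conv mu nu gamma ->
  moment gamma = moment mu.
Proof.
move=> nu0 [_ _ rE]; apply/funext => -[|n]; first by rewrite !moment0.
apply: moment_eq_of_free_cumulant => // k k0.
rewrite rE //.
rewrite -[free_cumulant (moment nu) k](@free_cumulant_unique _ _ (fun=> 0)) ?addr0 //.
by move=> j j0; rewrite nu0 // big1 // => P; exact: prod_blocks0.
Qed.

(** Here M = 1 and g = t, so that inf_moment_cumulant_fps reads m' t = u t. *)
Lemma inf_free_cumulant_dirac0 (m m' : nat -> R) :
  m 0%N = 1 -> (forall n, (0 < n)%N -> m n = 0) -> m' 0%N = 0 ->
  inf_free_cumulant m m' = m'.
Proof.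
move=> m0 m_eq0 m'0; have := inf_moment_cumulant_fps m0 m'0.
have -> : (m : fps R) = 1.
  by apply: fpsP => -[|n]; rewrite fpsE1 ?m0 // m_eq0.
rewrite mulr1 fpsDX !(mulrC _ (fpsX R)) => /fpsX_inj.
by rewrite fps_compX => /esym.
Qed.

Lemma real_rootsP d (p : {poly R}) : real_rooted d p ->
  p = \prod_(a <- real_roots p) ('X - a%:P) /\ size (real_roots p) = d.
Proof.
move=> [p1 sp pE]; have rE : p = \prod_(a <- real_roots p) ('X - a%:P).
  exact: (xgetPex [::] pE).
by split => //; apply: succn_inj; rewrite -sp {2}rE size_prod_XsubC.
Qed.

End Moments.

(** Subtracting the identities inf_moment_cumulant_fps for c' and m' leaves
    g (c' - m') = v(g) D g, and v = - D a / a turns the right-hand side into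
    - g D(a(g)) / a(g) by the chain rule. *)
Lemma inf_free_conv_log_deriv (R : realType) (m m' c' v a : nat -> R) :
  m 0%N = 1 -> m' 0%N = 0 -> c' 0%N = 0 -> v 0%N = 0 ->
  (forall n, (0 < n)%N ->
     inf_free_cumulant m c' n = inf_free_cumulant m m' n + v n) ->
  fpsD (a : fps R) = - ((a : fps R) * (v : fps R)) ->
  let g := fpsX R * (m : fps R) in
  fps_comp a g * ((c' : fps R) - (m' : fps R)) = - fpsD (fps_comp a g).
Proof.
move=> m0 m'0 c'0 v0 rE aE g.
have g0 : g 0%N = 0 by rewrite /g fpsEXM.
have gI (f h : fps R) : g * f = g * h -> f = h.
  by rewrite -!mulrA => /fpsX_inj/(fps_mulI m0).
have cE : (inf_free_cumulant m c' : fps R) =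
    (inf_free_cumulant m m' : fps R) + (v : fps R).
  by apply: fpsP => -[|n]; [rewrite fpsED v0 addr0|exact: rE].
have xE : g * ((c' : fps R) - (m' : fps R)) = fps_comp v g * fpsD g.
  have := inf_moment_cumulant_fps m0 c'0; have := inf_moment_cumulant_fps m0 m'0.
  rewrite -/g cE fps_compD mulrDl => <- c'E.
  by rewrite mulrBr !(mulrC g) c'E addrC addKr.
apply: gI; rewrite mulrCA xE mulrA -fps_compM // mulrN fpsD_comp // aE fps_compN.
by rewrite mulNr opprK.
Qed.

Theorem corollary4p7 (R : realType) (p q : nat -> {poly R})
    (mu nu gamma : probability (measurableTypeR R) R)
    (mu' nu' gamma' : {scalar {poly R}})
    (mu_det : moment_determinate mu) (nu_det : moment_determinate nu)
    (p_dist : has_inf_distribution p mu mu')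
    (q_dist : has_inf_distribution q nu nu')
    (gammaE : is_inf_free_conv mu mu' nu nu' gamma gamma')
    (nuE : forall A : set (measurableTypeR R), measurable A ->
       nu A = \d_(0 : R) A) :
  has_inf_distribution (fun d => ffconv d (p d) (q d)) gamma gamma'.
Proof.
have [p_rr _ p_mom mu'1 p_inf] := p_dist.
have [q_rr _ _ nu'1 q_inf] := q_dist.
have [gamma_conv gamma'1 inf_rE] := gammaE.
have [gamma_fin _ _] := gamma_conv.
have nu0 n : (0 < n)%N -> moment nu n = 0 by exact: moment_dirac0.
have gamma_mom := free_conv_dirac0_moment nu0 gamma_conv.
have inf0 (f : {scalar {poly R}}) : f 1 = 0 -> inf_moment f 0 = 0.
  by rewrite /inf_moment expr0.
have nu_cum := inf_free_cumulant_dirac0 (moment0 nu) nu0 (inf0 _ nu'1).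
pose r d := ffconv d (p d) (q d).
have r_rr d : (0 < d)%N -> real_rooted d (r d).
  by move=> d0; exact: real_rooted_ffconv (p_rr d d0) (q_rr d d0).
pose s d := real_roots (p d); pose t d := real_roots (q d).
pose u d := real_roots (r d).
have t_cvg : fps_cvg (fun d => power_sums (t d) - fpsC (size (t d))%:R)
    (inf_moment nu').
  (* The polynomials of index 0 are arbitrary: identities only hold for d > 0. *)
  move=> [|n].
    rewrite (inf0 _ nu'1); apply: (cvg_eventually (k := 0) (g := fun=> 0)) => [d d0|].
      by rewrite fpsED fpsEN power_sums0 subrr.
    exact: cvg_cst.
  apply: (cvg_eventually (k := 0)) (q_inf n.+1 isT) => d d0.
  rewrite nu0 // subr0 /poly_moment mulVKf ?pnatr_eq0 -?lt0n //.
  by rewrite fpsED fpsEN subr0.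
have [a [a0 a_cvg aE]] := rev_prod_cvg t_cvg.
have s_cvg : fps_cvg (fun d => fpsC (d%:R)^-1 * power_sums (s d)) (moment mu).
  by move=> n; under eq_fun do rewrite fpsECM; exact: p_mom.
pose B d := mix_quotients d (power_sums (s d)) (rev_prod (t d)).
have B_cvg := mix_quotients_cvg s_cvg a_cvg.
pose x d : fps R := power_sums (u d) - power_sums (s d).
have x_cvg : fps_cvg x ((inf_moment gamma' : fps R) - (inf_moment mu' : fps R)).
  apply: (fps_cvg_quotient _ B_cvg (fps_cvgN (fps_cvgD B_cvg))).
  - move=> d d0; split; first exact/mix_quotients0/rev_prod0.
    have [pE sE] := real_rootsP (p_rr d d0); have [qE tE] := real_rootsP (q_rr d d0).
    have [rE uE] := real_rootsP (r_rr d d0).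
    exact: (power_sums_ffconv pE sE qE tE rE uE).
  - by rewrite /fps_comp big_ord1 a0 mul1r.
  - apply: inf_free_conv_log_deriv aE => //; rewrite ?moment0 ?inf0 //.
    by move=> n n0; rewrite -nu_cum -gamma_mom inf_rE // gamma_mom.
have powE d n : power_sums (u d) n = power_sums (s d) n + x d n.
  by rewrite /x fpsED fpsEN addrC subrK.
split => // [n|n n0].
- have -> : moment gamma n = moment mu n +
      0 * ((inf_moment gamma' : fps R) - (inf_moment mu' : fps R)) n.
    by rewrite gamma_mom mul0r addr0.
  rewrite /poly_moment.
  have -> : (fun d =>
        d%:R^-1 * \sum_(b <- real_roots (ffconv d (p d) (q d))) b ^+ n) =
      (fun d => poly_moment d (p d) n + d%:R^-1 * x d n).
    by apply/funext => d; rewrite -[\sum_(b <- _) _]/(power_sums (u d) n) powE mulrDr.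
  apply: cvgD; first exact: p_mom.
  apply: cvgM (x_cvg n); have := @inv_subn_cvg0 R 0.
  by under eq_fun do rewrite subr0.
- have -> : inf_moment gamma' n = inf_moment mu' n +
      ((inf_moment gamma' : fps R) - (inf_moment mu' : fps R)) n.
    by rewrite fpsED fpsEN addrC subrK.
  apply: (cvg_eventually (k := 0)) (cvgD (p_inf n n0) (x_cvg n)) => d d0.
  rewrite [LHS](_ : _ = d%:R * (d%:R^-1 * power_sums (u d) n - moment gamma n)) //.
  rewrite [RHS](_ : _ =
    d%:R * (d%:R^-1 * power_sums (s d) n - moment mu n) + x d n) //.
  rewrite powE gamma_mom.
  have d1 : d%:R != 0 :> R by rewrite pnatr_eq0 -lt0n.
  by field.
Qed.
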